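(* The type $(1,1)$ categorical Gromov-Witten invariant of $A_n$ with gravitational descendant $u^l$ ($l\ge 0$, $0\le k\le n-1$) is given by $$\langle[\epsilon|\epsilon^k]u^l\rangle_{1,1}^{A_n}=\begin{cases}\frac n{24},&\text{if }k=n-1,\ l=1;\\0,&\text{otherwise.}\end{cases}$$
   Context: $\mathbb{K}$ is a field of characteristic $0$, $n\ge1$. Shifted sign conventions are used for $A_\infty$ algebras and signs $\pm$ are Koszul signs. $A_n=\mathrm{span}(\mathbf 1,\epsilon)$ is the $\mathbb{Z}/2\mathbb{Z}$-graded cyclic $A_\infty$ algebra with $\mathbf 1$ even and a strict unit, $\epsilon$ odd, only other non-zero operation $\mu_{n+1}(\epsilon,\dots,\epsilon)=\frac1{n+1}\mathbf 1$, and odd pairing $\langle\mathbf 1,\epsilon\rangle=1$. It is the minimal model of the category of matrix factorizations of $\frac1{n+1}x^{n+1}$. **Chains.** $L:=CC_{*+1}(A_n)$ is the shifted reduced Hochschild chain complex (unit killed in all slots but the $0$-th), with basis $\mathbf 1|\epsilon^k,\ \epsilon|\epsilon^k$ ($k\ge0$ copies of $\epsilon$ after the bar), $b(\mathbf 1|\epsilon^k)=0$, $b(\epsilon|\epsilon^k)=0$ for $k<n$ and $\mathbf 1|\epsilon^{k-n}$ for $k\ge n$, $B(\mathbf 1|\epsilon^k)=0$, $B(\epsilon|\epsilon^k)=(k+1)\mathbf 1|\epsilon^{k+1}$. Its homology has basis $[\epsilon|\epsilon^k]$, $0\le k\le n-1$. **Graph operations.** Put $c(a_1,\dots,a_{k+1})=\langle\mu_k(a_1,\dots,a_k),a_{k+1}\rangle$,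 $\{e_s\}$ a basis of $A_n$ and $\{e^s\}$ its dual basis. - Mukai pairing: $\langle a_0|\cdots|a_i,b_0|\cdots|b_j\rangle_{\rm Muk}=\sum\pm c(a_{q+1},..,a_i,a_0,..,a_p,e_s,b_{p'+1},..,b_{q'},e_t)\,c(b_{q'+1},..,b_j,b_0,..,b_{p'},e^s,a_{p+1},..,a_q,e^t)$ over $0\le p\le q\le i$, $0\le p'\le q'\le j$, $s,t$. - Coproduct: $\Delta(a_0|\cdots|a_k)=\sum\pm c(a_{l+1},..,a_k,a_0,..,a_r,e_p,a_{s+1},..,a_t,e_q)\,(e^p|a_{r+1}|\cdots|a_s)\otimes(e^q|a_{t+1}|\cdots|a_l)$ over $0\le r\le s\le t\le l\le k$ and $p,q$. - For a ribbon graph $G$ with one face and one leg (''input'') and no output, $\rho(G)(a_0|\cdots|a_k)$ is the signed sum, over all ways of placing $a_1,\dots,a_k$ in order in the corners met when going once around the face starting from the leg, of the contraction along the edges (by $\sum_s e_s\otimes e^s$) of the tensors $c$ put at the vertices, with $a_0$ on the leg. Let $G_2$ be the trivalent genus-one graph with edges $x,y,z,w$ and vertices with cyclic orders $(\mathrm{leg},x,z)$, $(y,w,z)$, $(w,x,y)$, and $G_3$ the graph with edges $x,w$ and one vertex with cyclic order $(\mathrm{leg},x,w,x,w)$. These operations are the action of the Kontsevich-Soibelman/Costello PROP of ribbon graph chains on moduli of curves with parametrized boundaries; trivalent graphs are oriented so as to represent the positive generator (class of a point) of $H_0$ of the corresponding moduli space, and the action is compatible with gluing. **Splitting.** Lift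 $[\epsilon|\epsilon^k]$ ($0\le k\le n-1$) to $\widetilde{\epsilon|\epsilon^k}=\sum_{l\ge0}(-1)^lc_{k,l}\,\epsilon|\epsilon^{k+nl+l}u^l\in L[[u]]$, $c_{k,0}=1$, $c_{k,l}=\prod_{j=0}^{l-1}(k+1+j(n+1))$; these are $(b+uB)$-closed. **Deformed Fock module and invariants.** Let $\langle\alpha u^i,\beta u^j\rangle_{\rm hres}=(-1)^i\langle\alpha,\beta\rangle_{\rm Muk}u^{i+j}$ on $L((u))$. The Weyl algebra $\mathcal W$ is generated over $\mathbb K[[\lambda]]$ by $L((u))$ with differential $b+uB$ and graded commutation relations $[x,y]=\mathrm{Res}_{u=0}\langle x,y\rangle_{\rm hres}\,du$. The deformed Fock module is the quotient of $\mathcal W$ by the left ideal imposing, for every $\alpha=\alpha_0+\alpha_1u+\cdots\in L[[u]]$, the relation $$\alpha=\big(T_1(\alpha_0)+T_2(\alpha_1)+T_3(\alpha_0)\big)\lambda+O(\lambda^2),$$ where $T_1(\alpha_0)=\frac12\sum(u^{-1}\alpha')(u^{-1}\alpha'')$ if $\Delta(\alpha_0)=\sum\alpha'\otimes\alpha''$, $T_2(\alpha_1)=\frac1{24}\rho(G_2)(\alpha_1)$, $T_3(\alpha_0)=-\frac14\rho(G_3)(\alpha_0)$. (The $\lambda^{2g-2+m}$-terms come from moduli of genus $g$ curves with $m$ marked boundaries; the higher order terms play no role for types $(0,3)$ and $(1,1)$.) In homology the splitting identifies the module with polynomials in the classes $u^{-j}\,\widetilde{\epsilon|\epsilon^i}$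 ($j\ge1$, $0\le i\le n-1$) with coefficients in $\mathbb K[[\lambda]]$. Costello's invariant $\langle[\epsilon|\epsilon^k]u^l\rangle_{1,1}^{A_n}$ is the coefficient of $\lambda$ in the constant (degree $0$ polynomial) term of the class of $\widetilde{\epsilon|\epsilon^k}\,u^l$ in this module.
   Formalization: The relation for α in L[[u]] is imposed only up to a linear chain homotopy, with arbitrary O(λ²) terms, and the deformed Fock module is assumed λ-torsion-free; imposed literally for all α, the relation forces λ=O(λ²) when n≥2. *)

(* Defs.v *)
From HB Require Import structures.
From mathcomp Require Import all_boot all_order all_algebra.
From mathcomp Require Import finmap.
From mathcomp Require Import boolp classical_sets functions cardinality fsbigop.
From mathcomp Require Import monalg.

Set Implicit Arguments.
Unset Strict Implicit.
Unset Printing Implicit Defensive.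

Import Order.TTheory GRing.Theory Num.Theory.
Local Open Scope ring_scope.

Record pseries (K : fieldType) := PSeries { pscoef : nat -> K }.

Section PowerSeries.
Context (K : fieldType).
Implicit Types f g h : pseries K.

HB.instance Definition _ := [isNew for @pscoef K].
HB.instance Definition _ := [Choice of pseries K by <:].

Lemma psP f g : (forall i, pscoef f i = pscoef g i) -> f = g.
Proof. by move=> e; apply: val_inj; apply/funext. Qed.

Definition psconst (a : K) : pseries K :=
  PSeries (fun i => if i == 0%N then a else 0).
Definition pslambda : pseries K := PSeries (fun i => (i == 1%N)%:R).
Definition psadd f g : pseries K := PSeries (fun i => pscoef f i + pscoef g i).
Definition psopp f : pseries K := PSeries (fun i => - pscoef f i).
Definition psmul f g : pseries K :=
  PSeries (fun m => \sum_(i < m.+1) pscoef f i * pscoef g (m - i)).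

Lemma psaddA : associative psadd.
Proof. by move=> f g h; apply: psP => i /=; rewrite addrA. Qed.
Lemma psaddC : commutative psadd.
Proof. by move=> f g; apply: psP => i /=; rewrite addrC. Qed.
Lemma psadd0 : left_id (psconst 0) psadd.
Proof. by move=> f; apply: psP => i /=; rewrite if_same add0r. Qed.
Lemma psaddN : left_inverse (psconst 0) psopp psadd.
Proof. by move=> f; apply: psP => i /=; rewrite if_same addNr. Qed.

HB.instance Definition _ :=
  GRing.isZmodule.Build (pseries K) psaddA psaddC psadd0 psaddN.

Let trunc (m : nat) f : {poly K} := \poly_(i < m.+1) pscoef f i.

Let psmulE m n f g : (m <= n)%N ->
  pscoef (psmul f g) m = (trunc n f * trunc n g)`_m.
Proof.
move=> le_mn; rewrite coefM /=; apply: eq_bigr => i _.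
rewrite !coef_poly !ltnS (leq_trans _ le_mn); last by rewrite -ltnS ltn_ord.
by rewrite (leq_trans (leq_subr _ _) le_mn).
Qed.

Lemma psmulC : commutative psmul.
Proof. by move=> f g; apply: psP => m; rewrite !(@psmulE m m) // mulrC. Qed.

Lemma psmulA : associative psmul.
Proof.
move=> f g h; apply: psP => m.
have eqt (p q : {poly K}) (r : {poly K}) :
    (forall i, (i <= m)%N -> p`_i = q`_i) -> (p * r)`_m = (q * r)`_m.
  move=> e; rewrite !coefM; apply: eq_bigr => i _.
  by rewrite e // -ltnS ltn_ord.
have trE f1 f2 i : (i <= m)%N ->
    (trunc m (psmul f1 f2))`_i = (trunc m f1 * trunc m f2)`_i.
  by move=> le_im; rewrite coef_poly ltnS le_im (@psmulE i m).
rewrite !(@psmulE m m) // (eqt _ _ _ (trE f g)).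
by rewrite mulrC (eqt _ _ _ (trE g h)) mulrC mulrA.
Qed.

Lemma psmul1 : left_id (psconst 1) psmul.
Proof.
move=> f; apply: psP => m /=.
by rewrite big_ord_recl /= mul1r subn0 big1 ?addr0 // => i _; rewrite mul0r.
Qed.

Lemma psmulDl : left_distributive psmul psadd.
Proof.
move=> f g h; apply: psP => m /=; rewrite -big_split /=.
by apply: eq_bigr => i _; rewrite mulrDl.
Qed.

Lemma psone_neq0 : psconst 1 != psconst 0.
Proof.
by apply/eqP => /(congr1 (fun f => pscoef f 0%N)) /= /eqP; rewrite oner_eq0.
Qed.

HB.instance Definition _ := GRing.Zmodule_isComNzRing.Build (pseries K)
  psmulA psmulC psmul1 psmulDl psone_neq0.

End PowerSeries.

Arguments psconst {K} a.
Arguments pslambda {K}.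

(* The basis {1, epsilon} of A_n is encoded by the booleans; as a boolean, a
   basis element is its unshifted parity.  All Koszul signs use the shifted
   parity, for which 1 is odd and epsilon is even. *)
Definition unitA : bool := false.
Definition eps : bool := true.
Definition shodd (e : bool) : bool := ~~ e.

Section Algebra.
Context (K : fieldType) (n : nat).

(* mu w e is the coefficient of e in mu_(size w)(w).  In the shifted
   conventions a strict unit satisfies mu_2(1, x) = x and
   mu_2(x, 1) = (-1)^|x| x. *)
Definition mu (w : seq bool) (e : bool) : K :=
  if w == nseq n.+1 eps then (if e == unitA then n.+1%:R^-1 else 0)
  else if w is [:: x; y] then
    if x == unitA then (e == y)%:R
    else if y == unitA then (-1) ^+ x * (e == x)%:R
    else 0
  else 0.

(* <1, epsilon> = 1; cyclic invariance of [cyc] for the shifted signs forces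
   <epsilon, 1> = -1. *)
Definition pairA (x y : bool) : K :=
  if x == y then 0 else if x == unitA then 1 else -1.

Definition cyc (w : seq bool) : K :=
  \sum_(e : bool) mu (take (size w).-1 w) e * pairA e (last unitA w).

(* The dual basis: sum_s e_s (x) e^s = 1 (x) epsilon + epsilon (x) 1.  This is
   the inverse of the pairing, including the Koszul sign for moving the odd
   pairing past e_s. *)
Definition dualA (s : bool) : bool := ~~ s.

End Algebra.

(* A letter carries its position in the word in which the operation is written
   before reordering: first the edge tensors e_s (x) e^s, in the order of the
   edges, then the inputs.  The sign of a rearranged word counts the
   inversions between odd letters. *)
Definition letter : Type := (nat * bool)%type.

Fixpoint inversions (w : seq letter) : nat :=
  if w is x :: w' then
    (count (fun y => [&& shodd x.2, shodd y.2 & (y.1 < x.1)%N]) w'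
     + inversions w')%N
  else 0%N.

Definition koszul (K : fieldType) (w : seq letter) : K := (-1) ^+ inversions w.

(* (e, k) stands for the basis chain e | epsilon^k. *)
Definition chain : Type := (bool * nat)%type.

Definition letters (pos : nat) (a : chain) : seq letter :=
  (pos, a.1) :: [seq ((pos + r)%N, eps) | r <- iota 1 a.2].

(* The letters of w with index in ]p, q]. *)
Definition between (p q : nat) (w : seq letter) : seq letter :=
  drop p.+1 (take q.+1 w).

(* The parity in L is the total shifted parity of the slots. *)
Definition chain_odd (a : chain) : bool := shodd a.1.

Notation L K := {malg K[chain]}.

Section GraphOperations.
Context (K : fieldType) (n : nat).

Definition cycl (w : seq letter) : K := cyc K n [seq x.2 | x <- w].

Definition muk_basis (A B : chain) : K :=
  let a := letters 4 A in
  let b := letters (4 + A.2.+1) B in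
  \sum_(p < A.2.+1) \sum_(q < A.2.+1 | (p <= q)%N)
  \sum_(p' < B.2.+1) \sum_(q' < B.2.+1 | (p' <= q')%N)
  \sum_(s : bool) \sum_(t : bool)
    let w1 := drop q.+1 a ++ take p.+1 a
                ++ (0%N, s) :: between p' q' b ++ [:: (2%N, t)] in
    let w2 := drop q'.+1 b ++ take p'.+1 b
                ++ (1%N, dualA s) :: between p q a ++ [:: (3%N, dualA t)] in
    koszul K (w1 ++ w2) * cycl w1 * cycl w2.

(* L (x) L is the free module on pairs of basis chains. *)
Definition coproduct_basis (A : chain) : {malg K[(chain * chain)%type]} :=
  let a := letters 4 A in
  \sum_(r < A.2.+1) \sum_(s < A.2.+1 | (r <= s)%N)
  \sum_(t < A.2.+1 | (s <= t)%N) \sum_(l < A.2.+1 | (t <= l)%N)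
  \sum_(p : bool) \sum_(q : bool)
    let w := drop l.+1 a ++ take r.+1 a
               ++ (0%N, p) :: between s t a ++ [:: (2%N, q)] in
    let x1 := (1%N, dualA p) :: between r s a in
    let x2 := (3%N, dualA q) :: between t l a in
    << koszul K (w ++ x1 ++ x2) * cycl w
       *g ((dualA p, (s - r)%N), (dualA q, (l - t)%N)) >>.

(* A ribbon graph with one leg: half-edges are natural numbers, the leg is 0, a
   vertex is the list of its half-edges in cyclic order, an edge is a pair of
   half-edges.  The order of the list of edges is the orientation (edges are
   odd, vertices are even). *)
Record ribbon := Ribbon {
  vertices : seq (seq nat);
  edges : seq (nat * nat)
}.

Definition vertex_next (G : ribbon) (h : nat) : nat :=
  let v := nth [::] (vertices G) (find (fun v => h \in v) (vertices G)) in
  next v h.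

Definition edge_index (G : ribbon) (h : nat) : nat :=
  find (fun e => (h == e.1) || (h == e.2)) (edges G).

Definition edge_opp (G : ribbon) (h : nat) : nat :=
  let e := nth (h, h) (edges G) (edge_index G h) in
  if h == e.1 then e.2 else e.1.

(* A half-edge h names the corner between h and the next half-edge of its
   vertex; this lists the corners of the face of the leg. *)
Definition corners (G : ribbon) : seq nat :=
  traject (fun h => edge_opp G (vertex_next G h)) 0%N
          (size (flatten (vertices G))).

(* f gives the number of inputs placed in each corner, and s the basis element
   e_s at the first end of each edge. *)
Definition rho_words (G : ribbon) (A : chain) (f : seq nat) (s : seq bool) :
    seq (seq letter) :=
  let E := size (edges G) in
  let a := letters (2 * E) A in
  let half h : letter :=
    let i := edge_index G h in
    if (i < E)%N then
      if h == (nth (0%N, 0%N) (edges G) i).1 then ((2 * i)%N, nth unitA s i)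
      else ((2 * i).+1, dualA (nth unitA s i))
    else ((2 * E)%N, A.1) in
  let ins h :=
    let j := index h (corners G) in
    take (nth 0%N f j) (drop (sumn (take j f)) (behead a)) in
  [seq flatten [seq half h :: ins h | h <- v] | v <- vertices G].

Definition rho_basis (G : ribbon) (A : chain) : K :=
  \sum_(f : (size (corners G)).-tuple 'I_A.2.+1
          | sumn [seq val i | i <- f] == A.2)
  \sum_(s : (size (edges G)).-tuple bool)
    let ws := rho_words G A [seq val i | i <- f] s in
    koszul K (flatten ws) * \prod_(w <- ws) cycl w.

(* Edges x = (1,2), z = (3,4), y = (5,6), w = (7,8); vertices (leg, x, z),
   (y, w, z), (w, x, y).  The positive orientation is determined by gluing: G2
   is the graph of the coproduct (edges x, z, the outputs being the far ends of
   x and z) followed by the graph of the Mukai pairing (edges y, w). *)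
Definition G2 : ribbon :=
  Ribbon [:: [:: 0; 1; 3]; [:: 5; 7; 4]; [:: 8; 2; 6]]%N
         [:: (1, 2); (3, 4); (5, 6); (7, 8)]%N.

(* Edges x = (1,2), w = (3,4); vertex (leg, x, w, x, w). *)
Definition G3 : ribbon :=
  Ribbon [:: [:: 0; 1; 3; 2; 4]]%N [:: (1, 2); (3, 4)]%N.

Definition linext (V : lmodType K) (f : chain -> V) (x : L K) : V :=
  \sum_(a <- msupp x) x@_a *: f a.

Definition bL : L K -> L K :=
  linext (fun a => if (a.1 == eps) && (n <= a.2)%N
                   then << (unitA, (a.2 - n)%N) >> : L K else 0).

Definition BL : L K -> L K :=
  linext (fun a => if a.1 == eps
                   then << a.2.+1%:R *g (unitA, a.2.+1) >> : L K else 0).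

Definition parL : L K -> L K :=
  linext (fun a => << (-1) ^+ chain_odd a *g a >> : L K).

Definition mukL (x y : L K) : K :=
  \sum_(a <- msupp x) \sum_(b <- msupp y) x@_a * y@_b * muk_basis a b.

Definition coproductL : L K -> {malg K[(chain * chain)%type]} :=
  linext coproduct_basis.

Definition rhoL (G : ribbon) (x : L K) : K :=
  \sum_(a <- msupp x) x@_a * rho_basis G a.

End GraphOperations.

Section Laurent.
Context (K : fieldType) (n : nat).

Definition laurent_pred : {pred int -> L K} :=
  fun x => `[< exists N : int, forall i : int, i < N -> x i = 0 >].

Lemma laurentP (x : int -> L K) :
  reflect (exists N : int, forall i : int, i < N -> x i = 0)
          (x \in laurent_pred).
Proof. exact: asboolP. Qed.

Lemma laurent_submod_closed : submod_closed laurent_pred.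
Proof.
split=> [|a x y /laurentP[N xN] /laurentP[M yM]].
  by apply/laurentP; exists 0.
apply/laurentP; exists (Order.min N M) => i; rewrite lt_min => /andP[iN iM].
suff -> : (a *: x + y) i = a *: x i + y i; last by [].
by rewrite xN // yM // scaler0 addr0.
Qed.

HB.instance Definition _ :=
  GRing.isSubmodClosed.Build K (int -> L K) laurent_pred laurent_submod_closed.

(* lcoef x i is the coefficient of u^i. *)
Record laurent := Laurent {
  lcoef : int -> L K;
  laurent_subproof : lcoef \in laurent_pred
}.

HB.instance Definition _ := [isSub for lcoef].
HB.instance Definition _ := [Choice of laurent by <:].
HB.instance Definition _ := [SubChoice_isSubLmodule of laurent by <:].

(* Membership in L[[u]]. *)
Definition is_power (x : laurent) : Prop := forall i : int, i < 0 -> lcoef x i = 0.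

Lemma umon_subproof (j : int) (a : L K) :
  (fun i : int => if i == j then a else 0) \in laurent_pred.
Proof. by apply/laurentP; exists j => i /lt_eqF ->. Qed.

(* a u^j *)
Definition umon (j : int) (a : L K) : laurent := Laurent (umon_subproof j a).

Lemma linext0 (V : lmodType K) (f : chain -> V) : linext f (0 : L K) = 0.
Proof. by rewrite /linext msupp0 big_seq_fset0. Qed.

Lemma dlau_subproof (x : laurent) :
  (fun i : int => bL n (lcoef x i) + BL (lcoef x (i - 1))) \in laurent_pred.
Proof.
case: x => x /= /laurentP[N xN]; apply/laurentP; exists N => i iN.
rewrite !xN ?/bL ?/BL ?linext0 ?addr0 //.
by apply: le_lt_trans iN; rewrite gerBl.
Qed.

Definition dlau (x : laurent) : laurent := Laurent (dlau_subproof x).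

Lemma parlau_subproof (x : laurent) :
  (fun i : int => parL (lcoef x i)) \in laurent_pred.
Proof.
case: x => x /= /laurentP[N xN]; apply/laurentP; exists N => i iN.
by rewrite xN // /parL linext0.
Qed.

Definition parlau (x : laurent) : laurent := Laurent (parlau_subproof x).

Definition homogeneous (p : bool) (x : laurent) : Prop :=
  parlau x = (-1) ^+ p *: x.

(* Res_{u=0} <x, y>_hres du; the sum has finite support. *)
Definition res_hres (x y : laurent) : K :=
  \sum_(i \in [set: int])
     (-1) ^+ `|i|%N * mukL n (lcoef x i) (lcoef y (- 1 - i)).

Definition split_coef (k l : nat) : K := \prod_(j < l) (k + 1 + j * n.+1)%:R.

Lemma splitting_subproof (k : nat) (m : int) :
  (fun i : int => if m <= i then
     let l := `|i - m|%N in
     << (-1) ^+ l * split_coef k l *g (eps, (k + n * l + l)%N) >> : L K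
   else 0) \in laurent_pred.
Proof. by apply/laurentP; exists m => i; rewrite ltNge => /negbTE ->. Qed.

(* u^m times the lift of [epsilon | epsilon^k]. *)
Definition splitting (k : nat) (m : int) : laurent :=
  Laurent (splitting_subproof k m).

End Laurent.

(* The free associative K[[lambda]]-algebra on the set L((u)).  The Weyl algebra
   is its quotient by [weyl_ideal]; its left ideals are represented by the left
   ideals of the free algebra containing [weyl_ideal]. *)
Notation freeW K := {malg (pseries K)[{fmonom (laurent K)}]}.

Section Weyl.
Context (K : fieldType) (n : nat).

Local Notation freeW := (freeW K).

Definition gen (x : laurent K) : freeW := << fmu x >>.

Definition sc (a : K) (x : freeW) : freeW := psconst a *: x.
Definition lam (x : freeW) : freeW := pslambda *: x.

Inductive weyl_ideal : freeW -> Prop :=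
| weyl_linear (a : K) (x y : laurent K) :
    weyl_ideal (gen (a *: x + y) - sc a (gen x) - gen y)
| weyl_commutator (p q : bool) (x y : laurent K) :
    homogeneous p x -> homogeneous q y ->
    weyl_ideal (gen x * gen y - (-1) ^+ (p && q) * (gen y * gen x)
                - sc (res_hres n x y) 1)
| weyl_add (x y : freeW) :
    weyl_ideal x -> weyl_ideal y -> weyl_ideal (x + y)
| weyl_mull (x y : freeW) : weyl_ideal y -> weyl_ideal (x * y)
| weyl_mulr (x y : freeW) : weyl_ideal x -> weyl_ideal (x * y).

(* The differential: the K[[lambda]]-linear odd derivation extending b + uB. *)
Fixpoint dword (w : seq (laurent K)) : freeW :=
  if w is x :: w' then
    gen (dlau n x) * (\prod_(y <- w') gen y) + gen (parlau x) * dword w'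
  else 0.

Definition dW (x : freeW) : freeW := \sum_(w <- msupp x) x@_w *: dword w.

(* T_1(alpha_0) + T_2(alpha_1) + T_3(alpha_0) for
   alpha = alpha_0 + alpha_1 u + ... *)
Definition T1 (a0 : L K) : freeW :=
  let D := coproductL n a0 in
  sc 2%:R^-1 (\sum_(c <- msupp D)
     sc D@_c (gen (umon (-1) << c.1 >>) * gen (umon (-1) << c.2 >>))).
Definition T2 (a1 : L K) : freeW := sc (24%:R^-1 * rhoL n G2 a1) 1.
Definition T3 (a0 : L K) : freeW := sc (- 4%:R^-1 * rhoL n G3 a0) 1.

Definition Tsum (alpha : laurent K) : freeW :=
  T1 (lcoef alpha 0) + T2 (lcoef alpha 1) + T3 (lcoef alpha 0).

(* Polynomials over K[[lambda]] in the variables (j, i), which stand for the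
   class u^-(j+1) splitting(epsilon | epsilon^i), 0 <= i <= n-1. *)
Local Notation fock_poly := {malg (pseries K)[{cmonom ((nat * 'I_n)%type)}]}.

(* The generators occurring here commute in the Weyl algebra, so the order of
   the factors is immaterial. *)
Definition fock_monomial (m : {cmonom ((nat * 'I_n)%type)}) : freeW :=
  \prod_(v <- finsupp m) gen (splitting K n v.2 (- (v.1.+1)%:Z)) ^+ m v.

Definition fock_eval (p : fock_poly) : freeW :=
  \sum_(m <- msupp p) p@_m *: fock_monomial m.

(* Equality of classes in the homology of W / J. *)
Definition homologous (J : freeW -> Prop) (x y : freeW) : Prop :=
  exists z : freeW, J (x - y - dW z).

(* J is a left ideal of W defining a deformed Fock module W / J.
   - The relation alpha = T(alpha) lambda + O(lambda^2) is imposed for every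
     alpha in L[[u]].  Its O(lambda^2) term [h] is arbitrary, and T is only
     fixed up to a chain homotopy [H]; H = 0 is the relation on the nose.  The
     homotopy is needed for a non-trivial module: the operations represent
     homology classes of moduli spaces, and for n >= 2 the relations with H = 0
     for epsilon| and epsilon|epsilon^n have a commutator which forces
     lambda = O(lambda^2) in the quotient.  On (b+uB)-closed alpha, H only
     contributes the exact term d(H(alpha)).
   - [fock_flat] and [fock_homology]: W / J has no lambda-torsion, and in
     homology the splitting identifies it with the polynomials [fock_poly]. *)
Record deformed_fock (J : freeW -> Prop) : Prop := DeformedFock {
  fock_weyl : forall x, weyl_ideal x -> J x;
  fock_add : forall x y, J x -> J y -> J (x + y);
  fock_mul : forall x y, J y -> J (x * y);
  fock_d : forall x, J x -> J (dW x);
  fock_relation : exists H : laurent K -> freeW,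
    (forall a x y, H (a *: x + y) = sc a (H x) + H y) /\
    forall alpha, is_power alpha -> exists h : freeW,
      J (gen alpha - lam (Tsum alpha + dW (H alpha) + H (dlau n alpha))
         - lam (lam h));
  fock_flat : forall x, J (lam x) -> J x;
  fock_homology : forall x, J (dW x) ->
    exists! p : fock_poly, homologous J x (fock_eval p)
}.

Definition fock_class (J : freeW -> Prop) (x : freeW) : fock_poly :=
  xget 0 [set p | homologous J x (fock_eval p)]%classic.

(* The coefficient of lambda in the constant term of the class of
   splitting(epsilon | epsilon^k) u^l. *)
Definition GW11 (J : freeW -> Prop) (k l : nat) : K :=
  pscoef ((fock_class J (gen (splitting K n k l%:Z)))@_mone) 1.

End Weyl.

(* Main.v *)
Require Import Defs.
From mathcomp Require Import all_boot all_order all_algebra.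
From mathcomp Require Import finmap.
From mathcomp Require Import boolp classical_sets fsbigop.
From mathcomp Require Import monalg.
From mathcomp Require Import ring zify.

(** Let S be the closed lift of epsilon|epsilon^k times u^l.  It lies in L[[u]],
    so the defining relation of the module reads S = lambda T + exact + O(lambda^2)
    with T = T_1 + T_2 + T_3.  The module has no lambda-torsion: the relation
    can be divided by lambda, the quotient t of S by lambda is closed, and if q
    is its class then lambda q is the class of S ([class_of_relation]).  The
    invariant is therefore the constant term of q modulo lambda.  Modulo lambda
    and exact terms t is T, and an evaluated polynomial that is exact modulo
    lambda is itself divisible by lambda ([exact_mod_lambda]); hence q may be
    replaced by any polynomial that agrees with T modulo lambda.

    T is computed by counting units.  The tensor c vanishes except on n+2
    epsilons and on three letters of which two are units ([cyc_neq0]), and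
    every edge of a graph carries exactly one unit.
    - T_3 = 0: the vertex of G_3 has two units but five half-edges ([rho_G3]).
    - T_2: the four units of G_2 sit in pairs on two of its three vertices,
      which then take no input; the third vertex takes all the inputs, and
      there are n-1 of them.  So T_2 vanishes except on epsilon|epsilon^(n-1).
      There, four labellings of the edges are possible.  Two of them cancel, and
      each of the other two contributes 1/(n+1) for each of the C(n+1,2)
      placements of the inputs in three corners: G_2 gives n ([rho_G2]).
      Since T_2 is applied to the coefficient of u, this is the case k = n-1,
      l = 1; for l = 0 that coefficient is a multiple of
      epsilon|epsilon^(k+n+1), which G_2 kills.
    - T_1 is a combination of products of two classes u^-1 epsilon|epsilon^s
      with s < n, and of the square of the odd class u^-1 1|, which is zero
      ([coproduct_eps], [gen_unit_sqr]).  A class u^-1 epsilon|epsilon^s differs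
      from its lift by an element of L[[u]], which the relation makes zero
      modulo lambda.  To apply this to the left factor it must be moved to the
      right; the commutator vanishes because epsilon|epsilon^i and
      epsilon|epsilon^j pair to zero unless i + j = n - 1 ([muk_eps]).  So T_1
      is a quadratic polynomial without constant term, modulo lambda. *)

Set Implicit Arguments.
Unset Strict Implicit.
Unset Printing Implicit Defensive.

Import Order.TTheory GRing.Theory Num.Theory.
Local Open Scope ring_scope.

(** * Linear maps out of a free module *)

Section LinearExtension.
Context (R : nzRingType) (M : choiceType) (V : lmodType R) (f : M -> V).

(** The operations on chains, the differential of the free algebra and the
    evaluation of polynomials are all of this form. *)
Definition lin_ext (x : {malg R[M]}) : V := \sum_(m <- msupp x) x@_m *: f m.

Lemma lin_extEw (d : {fset M}) (x : {malg R[M]}) :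
  (msupp x `<=` d)%fset -> lin_ext x = \sum_(m <- d) x@_m *: f m.
Proof.
move=> sxd; rewrite /lin_ext; apply: big_fset_incl => // m _ mx.
by rewrite (mcoeff_outdom mx) scale0r.
Qed.

Lemma lin_ext_linear (a : R) (x y : {malg R[M]}) :
  lin_ext (a *: x + y) = a *: lin_ext x + lin_ext y.
Proof.
pose d := (msupp x `|` msupp y `|` msupp (a *: x + y))%fset.
have dx : (msupp x `<=` d)%fset by rewrite /d -fsetUA fsubsetUl.
have dy : (msupp y `<=` d)%fset.
  by apply/fsubsetP => m my; rewrite /d !inE my orbT.
have dxy : (msupp (a *: x + y) `<=` d)%fset by rewrite /d fsubsetUr.
rewrite (lin_extEw dx) (lin_extEw dy) (lin_extEw dxy).
rewrite scaler_sumr -big_split; apply: eq_bigr => m _.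
by rewrite mcoeffD mcoeffZ scalerDl scalerA.
Qed.

Lemma lin_extU (a : R) (m : M) : lin_ext << a *g m >> = a *: f m.
Proof.
by rewrite (lin_extEw msuppU_le) big_seq_fset1 mcoeffUU.
Qed.

Lemma lin_ext0 : lin_ext 0 = 0.
Proof. by rewrite /lin_ext msupp0 big_seq_fset0. Qed.

Lemma lin_extD x y : lin_ext (x + y) = lin_ext x + lin_ext y.
Proof. by rewrite -[x]scale1r lin_ext_linear !scale1r. Qed.

Lemma lin_extZ a x : lin_ext (a *: x) = a *: lin_ext x.
Proof. by rewrite -[a *: x]addr0 lin_ext_linear lin_ext0 !addr0. Qed.

Lemma lin_ext_sum (I : Type) (r : seq I) (P : pred I) (F : I -> {malg R[M]}) :
  lin_ext (\sum_(i <- r | P i) F i) = \sum_(i <- r | P i) lin_ext (F i).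
Proof. by apply: (big_morph _ lin_extD lin_ext0). Qed.

End LinearExtension.

Lemma eq_lin_ext (R : nzRingType) (M : choiceType) (V : lmodType R)
    (f g : M -> V) x : f =1 g -> lin_ext f x = lin_ext g x.
Proof. by move=> fg; apply: eq_bigr => m _; rewrite fg. Qed.

Lemma lin_ext_comp (R : nzRingType) (M N : choiceType) (V : lmodType R)
    (f : N -> V) (g : M -> {malg R[N]}) x :
  lin_ext f (lin_ext g x) = lin_ext (fun m => lin_ext f (g m)) x.
Proof.
by rewrite [lin_ext g x]/lin_ext lin_ext_sum; apply: eq_bigr => m _; exact: lin_extZ.
Qed.

(** * The differential b + uB and the splitting *)

Section Chains.
Context (K : fieldType) (n : nat).

Lemma bL_lin_ext (x : L K) :
  bL n x = lin_ext (fun a : chain => if (a.1 == eps) && (n <= a.2)%N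
                                     then << (unitA, (a.2 - n)%N) >> : L K else 0) x.
Proof. by []. Qed.

Lemma BL_lin_ext (x : L K) :
  BL x = lin_ext (fun a : chain => if a.1 == eps
                                   then << a.2.+1%:R *g (unitA, a.2.+1) >> : L K else 0) x.
Proof. by []. Qed.

Lemma parL_lin_ext (x : L K) :
  parL x = lin_ext (fun a : chain => << (-1) ^+ chain_odd a *g a >> : L K) x.
Proof. by []. Qed.

Lemma lin_ext_opp (R : nzRingType) (M : choiceType) (V : lmodType R) (f : M -> V) x :
  lin_ext (fun m => - f m) x = - lin_ext f x.
Proof. by rewrite /lin_ext -sumrN; apply: eq_bigr => m _; rewrite scalerN. Qed.

Lemma lin_ext_fun0 (R : nzRingType) (M : choiceType) (V : lmodType R) (f : M -> V) x :
  f =1 (fun=> 0) -> lin_ext f x = 0.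
Proof. by move=> f0; apply: big1 => m _; rewrite f0 scaler0. Qed.

Lemma bLD (x y : L K) : bL n (x + y) = bL n x + bL n y.
Proof. exact: lin_extD. Qed.

Lemma BLD (x y : L K) : BL (x + y) = BL x + BL y.
Proof. exact: lin_extD. Qed.

Lemma parLD (x y : L K) : parL (x + y) = parL x + parL y.
Proof. exact: lin_extD. Qed.

Lemma bL_bL (x : L K) : bL n (bL n x) = 0.
Proof.
rewrite !bL_lin_ext lin_ext_comp.
apply: lin_ext_fun0 => -[[] m] /=; rewrite ?lin_ext0 //.
by case: ifP => _; rewrite ?lin_ext0 // lin_extU scaler0.
Qed.

Lemma bL_BL (x : L K) : bL n (BL x) = 0.
Proof.
rewrite BL_lin_ext bL_lin_ext lin_ext_comp.
apply: lin_ext_fun0 => -[[] m] /=; rewrite ?lin_ext0 //.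
by rewrite lin_extU scaler0.
Qed.

Lemma BL_bL (x : L K) : BL (bL n x) = 0.
Proof.
rewrite BL_lin_ext bL_lin_ext lin_ext_comp.
apply: lin_ext_fun0 => -[[] m] /=; rewrite ?lin_ext0 //.
by case: ifP => _; rewrite ?lin_ext0 // lin_extU scaler0.
Qed.

Lemma BL_BL (x : L K) : BL (BL x) = 0.
Proof.
rewrite !BL_lin_ext lin_ext_comp.
apply: lin_ext_fun0 => -[[] m] /=; rewrite ?lin_ext0 //.
by rewrite lin_extU scaler0.
Qed.

Lemma parL_bL (x : L K) : parL (bL n x) = - bL n (parL x).
Proof.
rewrite !parL_lin_ext !bL_lin_ext !lin_ext_comp -lin_ext_opp.
apply: eq_lin_ext => -[[] m] /=.
  rewrite lin_extU; case: ifP => _ /=; rewrite ?lin_ext0 ?scaler0 ?oppr0 // lin_extU /=.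
  rewrite /chain_odd /= expr0 scale1r expr1.
  by rewrite scale1r -monalgUN.
by rewrite lin_extU lin_ext0 scaler0 oppr0.
Qed.

Lemma parL_BL (x : L K) : parL (BL x) = - BL (parL x).
Proof.
rewrite !parL_lin_ext !BL_lin_ext !lin_ext_comp -lin_ext_opp.
apply: eq_lin_ext => -[[] m] /=.
  rewrite !lin_extU /= /chain_odd /= expr0 scale1r expr1.
  apply/malgP=> k; rewrite mcoeffZ mcoeffN !mcoeffU.
  by case: eqP => _; rewrite ?mulr0n ?mulr1n ?mulrN1 ?mulr0 ?oppr0.
by rewrite lin_extU lin_ext0 scaler0 oppr0.
Qed.

Lemma laurent_eq (x y : laurent K) : (forall i, lcoef x i = lcoef y i) -> x = y.
Proof. by move=> e; apply: val_inj; apply/funext. Qed.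

Lemma lcoef0 i : lcoef (0 : laurent K) i = 0.
Proof. by []. Qed.

Lemma lcoefZ a (x : laurent K) i : lcoef (a *: x) i = a *: lcoef x i.
Proof. by []. Qed.

Lemma lcoefN (x : laurent K) i : lcoef (- x) i = - lcoef x i.
Proof. by []. Qed.

Lemma dlau_dlau (x : laurent K) : dlau n (dlau n x) = 0.
Proof.
apply: laurent_eq => i; rewrite lcoef0 /= bLD BLD.
by rewrite bL_bL bL_BL BL_bL BL_BL !addr0.
Qed.

Lemma parlau_dlau (x : laurent K) : parlau (dlau n x) = - dlau n (parlau x).
Proof.
apply: laurent_eq => i; rewrite lcoefN /= parLD.
by rewrite parL_bL parL_BL opprD.
Qed.

(** The sum telescopes: consecutive terms are n+1 copies of epsilon apart, so B
    of one term and b of the next are both multiples of the same chain, and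
    c_(k,l+1) = c_(k,l) (k+1+l(n+1)) is the ratio that makes them cancel.  The
    condition on k makes b vanish on the first term. *)
Lemma dlau_splitting k m : (k < n)%N -> dlau n (splitting K n k m) = 0.
Proof.
move=> kn; apply: laurent_eq => i; rewrite lcoef0 /=.
case: (lerP m i) => mi; last first.
  have -> : (m <= i - 1) = false by lia.
  by rewrite bL_lin_ext BL_lin_ext !lin_ext0 addr0.
rewrite bL_lin_ext lin_extU /=.
case: (lerP m (i - 1)) => mi1; last first.
  have -> : i = m by lia.
  rewrite subrr /= muln0 !addn0 leqNgt kn /= scaler0 add0r.
  by rewrite BL_lin_ext lin_ext0.
rewrite BL_lin_ext lin_extU /=.
have [l il] : exists l : nat, i = m + l.+1%:Z by exists (absz (i - m)%R).-1; lia.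
have -> : absz (i - m)%R = l.+1 by lia.
have -> : absz (i - 1 - m)%R = l by lia.
have nk : (n <= k + n * l.+1 + l.+1)%N by nia.
rewrite nk; apply/malgP => c; rewrite mcoeffD !mcoeffZ mcoeff0 !mcoeffU.
have -> : (k + n * l.+1 + l.+1 - n = (k + n * l + l).+1)%N by nia.
case: eqP => _; rewrite ?mulr0n ?mulr0 ?addr0 // !mulr1n mulr1.
rewrite /split_coef big_ord_recr /=.
have -> : (k + 1 + l * n.+1 = (k + n * l + l).+1)%N by nia.
by rewrite exprS mulN1r !mulNr !mulrA addNr.
Qed.

End Chains.

(** * The cyclic tensors of A_n *)

Section Cyc.
Context (K : fieldType) (n : nat).

Lemma cyc_rcons v y :
  cyc K n (rcons v y) = \sum_(e : bool) mu K n v e * pairA K e y.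
Proof.
rewrite /cyc size_rcons last_rcons -cats1 take_size_cat //.
Qed.

(** Besides mu_(n+1) on epsilons, the only operation is the product with the unit,
    and the pairing of its result with the last letter leaves one epsilon.  All
    the vanishing statements below count letters and units with this lemma. *)
Lemma cyc_neq0 w : cyc K n w != 0 ->
  (size w == n.+2) && all id w || (size w == 3) && (count negb w == 2).
Proof.
case/lastP: w => [|v y].
  by rewrite /cyc /mu /= big1 ?eqxx // => e _; rewrite mul0r.
rewrite cyc_rcons /mu size_rcons all_rcons -cats1 count_cat.
have [->|_] := eqVneq v (nseq n.+1 eps).
  rewrite size_nseq all_nseq orbT !andbT big_bool /= mul0r add0r.
  by case: y; rewrite ?eqxx // /pairA /= mulr0 eqxx.
rewrite big_bool /=.
case: v => [|a [|b [|c v]]]; rewrite ?mul0r ?addr0 ?eqxx // => h.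
by apply/orP; right; move: h; rewrite /pairA; case: a; case: b; case: y;
  rewrite /= ?(mul0r, mulr0, addr0, add0r, eqxx) //.
Qed.

Lemma cyc_nseq m : cyc K n (nseq m true) = (m == n.+2)%:R / n.+1%:R.
Proof.
have [->|mn] := eqVneq m n.+2; last first.
  rewrite mul0r; apply/eqP; apply: contraNT mn => /cyc_neq0.
  by rewrite size_nseq count_nseq mul0n andbF orbF => /andP[].
have -> : nseq n.+2 true = rcons (nseq n.+1 true) true.
  by rewrite -cats1 -[[:: true]]/(nseq 1 true) cat_nseq /ncons -iterD addn1.
by rewrite cyc_rcons big_bool /mu eqxx /= mul0r add0r mul1r mulr1.
Qed.

Definition unital_cyc (x y z : bool) : K :=
  if (x, y, z) is (false, false, true) then 1
  else if (x, y, z) is (false, true, false) then -1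
  else if (x, y, z) is (true, false, false) then 1 else 0.

Lemma cyc_unital x y z : ~~ [&& x, y & z] -> cyc K n [:: x; y; z] = unital_cyc x y z.
Proof.
rewrite -[[:: x; y; z]]/(rcons [:: x; y] z) cyc_rcons big_bool.
case: x; case: y; case: z => //= _;
  rewrite /mu /pairA /unital_cyc /= ?andbF /=
    ?(mul0r, mulr0, addr0, add0r, mul1r, mulr1, expr1, mulrNN).
all: by case: (n) => [|[|m]]; rewrite /= ?(mul0r, mulN1r, opprK).
Qed.

Definition padded_cyc (x y z : bool) (m : nat) : K :=
  if [&& x, y & z] then (m.+1 == n)%:R / n.+1%:R else (m == 0%N)%:R * unital_cyc x y z.

(** The inputs of a trivalent vertex count only through their number: their
    positions in the three corners are immaterial. *)
Lemma cyc_padded x y z i j k :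
  cyc K n (x :: nseq i true ++ y :: nseq j true ++ z :: nseq k true)
  = padded_cyc x y z (i + j + k).
Proof.
rewrite /padded_cyc; set w := (x :: _).
have sw : size w = (i + j + k).+3.
  by rewrite /w /= !size_cat /= size_cat /= !size_nseq; lia.
have aw : all id w = [&& x, y & z].
  by rewrite /w /= !all_cat /= all_cat /= !all_nseq !orbT andbT.
case: ifPn => xyz.
  have -> : w = nseq (i + j + k).+3 true.
    by rewrite -sw; apply/all_pred1P; rewrite (eq_all (a2 := id)) ?aw //; case.
  by rewrite cyc_nseq !eqSS.
have [/eqP|m0] := boolP ((i + j + k)%N == 0%N).
  rewrite mul1r -cyc_unital // => e0; rewrite /w.
  have [-> -> ->] : [/\ i = 0, j = 0 & k = 0]%N by split; lia.
  by [].
rewrite mul0r; apply/eqP; apply: contraNT m0 => /cyc_neq0.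
by rewrite sw aw (negbTE xyz) andbF orFb !eqSS => /andP[].
Qed.

End Cyc.

(** As epsilon is even for the shifted parity, the inputs of a chain
    epsilon|epsilon^k contribute no sign. *)
Lemma inversions_filter w :
  inversions w = inversions [seq x <- w | shodd x.2].
Proof.
elim: w => //= x w ->; case: ifP => ox /=.
  congr (_ + _)%N; rewrite count_filter; apply: eq_count => y /=.
  by rewrite ox /=; case: (shodd y.2); rewrite ?andbT ?andbF.
by rewrite (eq_count (a2 := pred0)) ?count_pred0.
Qed.

(** * Counting the placements of the inputs *)

Lemma sumn_take_nth (f : seq nat) j :
  (sumn (take j f) + nth 0 f j <= sumn f)%N.
Proof.
elim: f j => [|a f IH] [|j] //=; first by rewrite leq_addr.
by rewrite -addnA leq_add2l.
Qed.

Lemma big_tcons (V : nmodType) (T : finType) m (F : seq T -> V) :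
  \sum_(s : m.+1.-tuple T) F s = \sum_(b : T) \sum_(s : m.-tuple T) F (b :: s).
Proof.
rewrite pair_big /= (reindex (fun p : T * m.-tuple T => [tuple of p.1 :: p.2])) //=.
exists (fun s => (thead s, [tuple of behead s])).
  by move=> [b s] _; apply/eqP; rewrite xpair_eqE theadE eqxx; apply/eqP/val_inj.
by move=> s _ /=; rewrite -tuple_eta.
Qed.

Lemma big_tnil (V : nmodType) (T : finType) (F : seq T -> V) :
  \sum_(s : 0.-tuple T) F s = F [::].
Proof.
rewrite (bigD1 [tuple]) //= big1 ?addr0 // => s /eqP[].
exact: tuple0.
Qed.

Lemma big_tuple4 (V : nmodType) (T : finType) (F : seq T -> V) :
  \sum_(s : 4.-tuple T) F s
  = \sum_(a : T) \sum_(b : T) \sum_(c : T) \sum_(e : T) F [:: a; b; c; e].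
Proof.
rewrite big_tcons; apply: eq_bigr => a _.
rewrite (big_tcons _ (fun s => F (a :: s))); apply: eq_bigr => b _.
rewrite (big_tcons _ (fun s => F [:: a, b & s])); apply: eq_bigr => c _.
rewrite (big_tcons _ (fun s => F [:: a, b, c & s])); apply: eq_bigr => e _.
exact: (big_tnil (fun s => F [:: a, b, c, e & s])).
Qed.

(** Forgetting the entries outside the image of h is a bijection onto the (d+1)-tuples of sum k. *)
Lemma card_tuples_supported_on_image m d k (h : 'I_d.+1 -> 'I_m) : injective h ->
  #|[set f : m.-tuple 'I_k.+1 | (\sum_(i <- f) val i == k)%N &&
      [forall i, (i \in h @: [set: 'I_d.+1]) || (tnth f i == ord0)]]| = 'C(d + k, d).
Proof.
move=> hi; rewrite -(card_ord_partitions d k).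
pose F (f : m.-tuple 'I_k.+1) := [tuple tnth f (h j) | j < d.+1].
have sumF (f : m.-tuple 'I_k.+1) :
    [forall i, (i \in h @: [set: 'I_d.+1]) || (tnth f i == ord0)] ->
    (\sum_(i <- f) val i = \sum_(i <- F f) val i)%N.
  move=> /forallP f0; rewrite !big_tuple (bigID (mem (h @: [set: 'I_d.+1]))) /=.
  rewrite [X in (_ + X)%N]big1 ?addn0; last first.
    by move=> i /negbTE hi0; move: (f0 i); rewrite hi0 => /eqP ->.
  rewrite big_imset /=; last by move=> x y _ _ /hi.
  by apply: eq_big => [j|j _]; [rewrite finset.in_setT | rewrite tnth_mktuple].
rewrite -(card_in_imset (f := F)) => [|f g]; last first.
  rewrite !inE => /andP[_ /forallP f0] /andP[_ /forallP g0] /(congr1 (fun t => tnth t)) e.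
  apply: eq_from_tnth => i; case: (boolP (i \in h @: [set: 'I_d.+1])) => [/imsetP[j _ ->]|].
    by move: (congr1 (fun t => t j) e); rewrite !tnth_mktuple.
  by move=> /negbTE hi0; move: (f0 i) (g0 i); rewrite hi0 => /eqP -> /eqP ->.
apply: eq_card => t; rewrite inE; apply/imsetP/idP => [[f]|st].
  by rewrite inE => /andP[/eqP sf f0] ->; rewrite -sumF ?sf.
pose f := [tuple if [pick j | h j == i] is Some j then tnth t j else ord0 | i < m].
have f0 : [forall i, (i \in h @: [set: 'I_d.+1]) || (tnth f i == ord0)].
  apply/forallP => i; rewrite tnth_mktuple; case: pickP => [j /eqP <-|_].
    by rewrite imset_f.
  by rewrite eqxx orbT.
have Ff : F f = t.
  apply: eq_from_tnth => j; rewrite !tnth_mktuple; case: pickP => [j' /eqP/hi -> //|].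
  by move/(_ j); rewrite eqxx.
by exists f; rewrite ?Ff // inE sumF // Ff st.
Qed.

Lemma card_tuples_supported m d k (p : seq nat) :
  uniq p -> size p = d.+1 -> all (fun i => i < m)%N p ->
  #|[set f : m.-tuple 'I_k.+1 | (\sum_(i <- f) val i == k)%N &&
      [forall i, (val i \in p) || (tnth f i == ord0)]]| = 'C(d + k, d).
Proof.
move=> up sp /(all_nthP 0%N) pm.
have pj (j : 'I_d.+1) : (j < size p)%N by rewrite sp.
pose h (j : 'I_d.+1) := Ordinal (pm j (pj j)).
have hi : injective h.
  by move=> i j /(congr1 val)/eqP; rewrite /= nth_uniq // => /eqP/val_inj.
rewrite -(card_tuples_supported_on_image k hi); apply: eq_card => f.
rewrite !inE; congr (_ && _); apply: eq_forallb => i; congr (_ || _).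
apply/idP/imsetP => [/(nthP 0%N)[j jp ij]|[j _ ->]]; last by rewrite mem_nth.
by exists (Ordinal (etrans (congr1 (leq j.+1) (esym sp)) jp)) => //; apply: val_inj.
Qed.

(** * The operations of the ribbon graphs G2 and G3 *)

Section Rho.
Context (K : fieldType) (n : nat).

Definition corner_inputs (E : nat) (k : nat) (f : seq nat) (j : nat) : seq letter :=
  take (nth 0%N f j) (drop (sumn (take j f)) (behead (letters E (eps, k)))).

Lemma behead_letters E k :
  [seq x.2 | x <- behead (letters E (eps, k))] = nseq k true.
Proof.
set s := map _ _; have <- : size s = k by rewrite /s /= !size_map size_iota.
by apply/all_pred1P; rewrite /s /= -map_comp all_map; apply/allP.
Qed.

Lemma corner_inputs_eps E k f j : sumn f = k ->
  [seq x.2 | x <- corner_inputs E k f j] = nseq (nth 0%N f j) true.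
Proof.
move=> sf; rewrite /corner_inputs map_take map_drop behead_letters drop_nseq take_nseq //.
by rewrite -sf leq_subRL ?sumn_take_nth // (leq_trans _ (sumn_take_nth f j)) ?leq_addr.
Qed.

Lemma corner_inputs_even E k f j : sumn f = k ->
  [seq x <- corner_inputs E k f j | shodd x.2] = [::].
Proof.
move=> sf; apply/eqP; rewrite -[_ == _]negbK -has_filter -all_predC.
rewrite (eq_all (a2 := preim snd id)) -?all_map ?corner_inputs_eps //=.
  by rewrite all_nseq orbT.
by case=> p [].
Qed.

Lemma corners_G2 : corners G2 = [:: 0; 2; 5; 8; 1; 4; 6; 7; 3]%N.
Proof. by []. Qed.

Lemma corners_G3 : corners G3 = [:: 0; 2; 3; 1; 4]%N.
Proof. by []. Qed.

(** Blocks of inputs are numbered along the face, as in [corners_G2], whereas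
    the words follow the cyclic orders at the vertices. *)
Lemma rho_words_G2 k f b0 b1 b2 b3 :
  rho_words G2 (eps, k) f [:: b0; b1; b2; b3] =
  let I := corner_inputs 8 k f in
  [:: (8, true) :: I 0 ++ (0, b0) :: I 4 ++ (2, b1) :: I 8;
      (4, b2) :: I 2 ++ (6, b3) :: I 7 ++ (3, ~~ b1) :: I 5;
      (7, ~~ b3) :: I 3 ++ (1, ~~ b0) :: I 1 ++ (5, ~~ b2) :: I 6]%N.
Proof.
rewrite /rho_words corners_G2 -[(2 * size (edges G2))%N]/(8%N) /corner_inputs.
rewrite -[behead _]/(behead (letters 8 (eps, k))).
move: (behead _) => a; rewrite [vertices G2]/= [map _ _]/= !cats0.
by [].
Qed.

Lemma rho_words_G3 k f b0 b1 :
  rho_words G3 (eps, k) f [:: b0; b1] =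
  let I := corner_inputs 4 k f in
  [:: (4, true) :: I 0 ++ (0, b0) :: I 3 ++ (2, b1) :: I 2
      ++ (1, ~~ b0) :: I 1 ++ (3, ~~ b1) :: I 4]%N.
Proof.
rewrite /rho_words corners_G3 -[(2 * size (edges G3))%N]/(4%N) /corner_inputs.
rewrite -[behead _]/(behead (letters 4 (eps, k))).
move: (behead _) => a; rewrite [vertices G3]/= [map _ _]/= !cats0.
by [].
Qed.

Lemma pair_tuple (s : 2.-tuple bool) : exists b0 b1, s = [:: b0; b1] :> seq bool.
Proof. by case: s => -[|b0 [|b1 [|? ?]]] // ?; exists b0, b1. Qed.

(** The units of both edges are at the same vertex, which would have to be
    trivalent. *)
Lemma rho_G3 k : rho_basis K n G3 (eps, k) = 0.
Proof.
rewrite /rho_basis; apply: big1 => f /eqP sf; apply: big1 => s _.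
set fs := [seq val i | i <- f] in sf *; move: fs sf => fs sf.
have [b0 [b1 ->]] := pair_tuple s.
rewrite rho_words_G3 big_cons big_nil mulr1.
set w := (X in cycl K n X); apply/eqP; rewrite mulf_eq0; apply/orP; right.
apply: contraT => /cyc_neq0.
rewrite {}/w /= !map_cat /= !map_cat /= !map_cat /= !map_cat /=.
rewrite !corner_inputs_eps //; do 4 rewrite ?(size_cat, count_cat, all_cat) /=.
by case: b0; case: b1; rewrite /= ?andbF //= !addnS ?eqSS.
Qed.

(** The contribution of one labelling of the edges.  The inputs enter it only
    through their numbers N1, N2, N3 at the three vertices. *)
Definition G2_summand b0 b1 b2 b3 N1 N2 N3 : K :=
  koszul K [seq x <- [:: (8, true); (0, b0); (2, b1); (4, b2); (6, b3); (3, ~~ b1);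
               (7, ~~ b3); (1, ~~ b0); (5, ~~ b2)] | shodd x.2]%N
  * (padded_cyc K n true b0 b1 N1 * (padded_cyc K n b2 b3 (~~ b1) N2
      * padded_cyc K n (~~ b3) (~~ b0) (~~ b2) N3)).

Lemma G2_summandE k f b0 b1 b2 b3 : sumn f = k ->
  let ws := rho_words G2 (eps, k) f [:: b0; b1; b2; b3] in
  koszul K (flatten ws) * \prod_(w <- ws) cycl K n w =
  G2_summand b0 b1 b2 b3 (nth 0 f 0 + nth 0 f 4 + nth 0 f 8)
    (nth 0 f 2 + nth 0 f 7 + nth 0 f 5) (nth 0 f 3 + nth 0 f 1 + nth 0 f 6).
Proof.
move=> sf; rewrite rho_words_G2 /=; congr (_ * _).
  rewrite /koszul inversions_filter; congr (_ ^+ inversions _).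
  by case: b0; case: b1; case: b2; case: b3;
    rewrite cats0; do 6 rewrite ?filter_cat /= ?corner_inputs_even ?cat0s //.
rewrite !big_cons big_nil mulr1 /cycl /=.
by rewrite !map_cat /= !map_cat /= !corner_inputs_eps // !cyc_padded.
Qed.

(** The four units are distributed in pairs over two vertices.  There are two ways
    to leave the vertex of the leg without unit; they have opposite signs, and
    this is why no term with N2 = N3 = 0 survives. *)
Lemma sum_G2_summand N1 N2 N3 :
  \sum_(b0 : bool) \sum_(b1 : bool) \sum_(b2 : bool) \sum_(b3 : bool)
    G2_summand b0 b1 b2 b3 N1 N2 N3
  = ((N1 == 0%N) && (N3 == 0%N) && (N2.+1 == n) +
     (N1 == 0%N) && (N2 == 0%N) && (N3.+1 == n))%:R / n.+1%:R.
Proof.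
rewrite !big_bool /G2_summand /padded_cyc /unital_cyc /koszul.
rewrite /= ?(mulr0, mul0r, addr0, add0r, mulr1, mul1r, expr0, expr1).
(* The two labellings that cancel have four inversions each; their opposite
   signs come from the tensors c. *)
rewrite -[(1 + (1 + (1 + 0)) + _)%N]/4%N -[(1 + (0 + (1 + 0)) + _)%N]/4%N.
rewrite natrD -!mulnb !natrM.
by ring.
Qed.

(** All the inputs are at the second or all at the third vertex; in both cases
    they are spread over three corners in C(n+1,2) ways, and the vertex
    contributes 1/(n+1). *)
Lemma rho_G2 k : [pchar K] =i pred0 ->
  rho_basis K n G2 (eps, k) = if k.+1 == n then n%:R else 0.
Proof.
move=> charK.
have n1 : n.+1%:R != 0 :> K by rewrite ((pcharf0P K).1 charK).
pose supported (f : 9.-tuple 'I_k.+1) (p : seq nat) :=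
  [forall i, (val i \in p) || (tnth f i == ord0)].
(* The positions, along the face, of the corners of the second and of the
   third vertex. *)
pose p2 := [:: 2; 5; 7]%N; pose p3 := [:: 1; 3; 6]%N.
transitivity (\sum_(f : 9.-tuple 'I_k.+1 | (\sum_(i <- f) val i == k)%N)
  ((k.+1 == n)%:R * ((supported f p2 + supported f p3)%:R / n.+1%:R)) : K).
  rewrite /rho_basis -[edges G2]/[:: (1, 2); (3, 4); (5, 6); (7, 8)]%N corners_G2.
  rewrite [size _]/= [size _]/=.
  apply: eq_big => [f|f /eqP sf]; first by rewrite sumnE big_map.
  set fs := [seq val i | i <- f] in sf *.
  rewrite (big_tuple4 (fun s => let ws := rho_words G2 (eps, k) fs s in
    koszul K (flatten ws) * \prod_(w <- ws) cycl K n w)).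
  transitivity (\sum_(b0 : bool) \sum_(b1 : bool) \sum_(b2 : bool) \sum_(b3 : bool)
    G2_summand b0 b1 b2 b3 (nth 0 fs 0 + nth 0 fs 4 + nth 0 fs 8)
      (nth 0 fs 2 + nth 0 fs 7 + nth 0 fs 5) (nth 0 fs 3 + nth 0 fs 1 + nth 0 fs 6)).
    by do 4 (apply: eq_bigr => ? _); apply: G2_summandE.
  rewrite sum_G2_summand mulrA -natrM; congr (_%:R / _).
  have supportedE p : supported f p =
      all (fun i => (i \in p) || (nth 0%N fs i == 0%N)) (iota 0 9).
    have fi (i : 'I_9) : nth 0%N fs i = tnth f i.
      by rewrite /fs (nth_map ord0) ?size_tuple // (tnth_nth ord0).
    apply/forallP/allP => [hf i|hf i].
      rewrite mem_iota /= => i9; move: (hf (Ordinal i9)).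
      rewrite -[nth _ _ _]/(nth 0%N fs (Ordinal i9)) fi.
      by case/orP=> [->|/eqP ->]; rewrite ?orbT.
    move: (hf (val i)); rewrite mem_iota /= ltn_ord => /(_ isT).
    by rewrite fi => /orP[->|/eqP e] //; apply/orP; right; apply/eqP/val_inj.
  have sfs : size fs = 9 by rewrite size_map size_tuple.
  rewrite !supportedE; move: fs sf sfs {supportedE} => fs.
  case: fs => [|a0 [|a1 [|a2 [|a3 [|a4 [|a5 [|a6 [|a7 [|a8 [|? ?]]]]]]]]]] //= sk _.
  set N1 := (a0 + a4 + a8)%N; set N2 := (a2 + a7 + a5)%N.
  set N3 := (a3 + a1 + a6)%N.
  have sN : (N1 + N2 + N3 = k)%N by move: sk; rewrite /N1 /N2 /N3 /=; lia.
  have -> : (N1 == 0%N) && (N3 == 0%N) && (N2.+1 == n) =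
      (k.+1 == n) && ((N1 == 0%N) && (N3 == 0%N)).
    have [e1|_] := eqVneq N1 0%N; last by rewrite /= andbF.
    have [e3|_] := eqVneq N3 0%N; last by rewrite /= andbF.
    by rewrite -sN e1 e3 add0n addn0 /= andbT.
  have -> : (N1 == 0%N) && (N2 == 0%N) && (N3.+1 == n) =
      (k.+1 == n) && ((N1 == 0%N) && (N2 == 0%N)).
    have [e1|_] := eqVneq N1 0%N; last by rewrite /= andbF.
    have [e2|_] := eqVneq N2 0%N; last by rewrite /= andbF.
    by rewrite -sN e1 e2 /= andbT.
  rewrite -!mulnb -mulnDr !mulnb /N1 /N2 /N3 !addn_eq0 !andbT.
  congr (_ * (nat_of_bool _ + nat_of_bool _))%N.
    by case: (a0 == 0%N) (a4 == 0%N) (a8 == 0%N) (a3 == 0%N) (a1 == 0%N) (a6 == 0%N)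
      => [] [] [] [] [] [].
  by case: (a0 == 0%N) (a4 == 0%N) (a8 == 0%N) (a2 == 0%N) (a7 == 0%N) (a5 == 0%N)
      => [] [] [] [] [] [].
case: eqP => [kn|_]; last by apply: big1 => f _; rewrite mul0r.
have sum_supported p : uniq p -> size p = 3 -> all (fun i => i < 9)%N p ->
   \sum_(f : 9.-tuple 'I_k.+1 | (\sum_(i <- f) val i == k)%N) (supported f p)%:R
   = 'C(2 + k, 2)%:R :> K.
  move=> up sp p9; rewrite -(card_tuples_supported k up sp p9) -sum1_card natr_sum.
  rewrite big_mkcond [RHS]big_mkcond; apply: eq_bigr => f _.
  by rewrite inE -/(supported f p); case: (_ == k) => //; case: (supported f p).
rewrite -big_distrr /= mul1r -mulr_suml.
under eq_bigr => f _ do rewrite natrD.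
rewrite big_split /= !sum_supported // -natrD addnn -mul2n.
have -> : (2 * 'C(2 + k, 2) = n.+1 * n)%N by rewrite add2n -mul_bin_diag bin1 kn.
by rewrite natrM mulrAC divff // mul1r.
Qed.

End Rho.

(** * Mukai pairing and coproduct *)

Section PairingCoproduct.
Context (K : fieldType) (n : nat).

Lemma letters_snd E k : [seq x.2 | x <- letters E (eps, k)] = nseq k.+1 true.
Proof.
by rewrite -[letters _ _]/((E, eps) :: behead (letters E (eps, k))) /= behead_letters.
Qed.

Lemma between_snd E k p q : (q <= k)%N ->
  [seq x.2 | x <- between p q (letters E (eps, k))] = nseq (q - p) true.
Proof.
by move=> qk; rewrite /between map_drop map_take letters_snd take_nseq // drop_nseq subSS.
Qed.

(** In the pairing as in the coproduct, the word read around a vertex has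
    this shape: the end of the chain and its beginning, separated from a middle
    block b by the ends s and t of two edges. *)
Lemma face_word E k (l r : nat) s t u v b : (r <= k)%N ->
  [seq x.2 | x <- drop l.+1 (letters E (eps, k)) ++ take r.+1 (letters E (eps, k))
     ++ (u, s) :: b ++ [:: (v, t)]]
  = nseq (k - l) true ++ nseq r.+1 true ++ s :: [seq x.2 | x <- b] ++ [:: t].
Proof.
move=> rk; rewrite !map_cat map_cons map_cat map_drop map_take letters_snd drop_nseq.
by rewrite subSS take_nseq.
Qed.

Lemma face_word_neq0 a b c s t :
  cyc K n (nseq a true ++ nseq b true ++ s :: nseq c true ++ [:: t]) != 0 ->
  [&& s, t & (a + b + c == n)%N] || [&& ~~ s, ~~ t & (a + b + c == 1)%N].
Proof.
move/cyc_neq0.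
do 4 rewrite ?(size_cat, count_cat, all_cat, size_nseq, count_nseq, all_nseq) /=.
have -> : (a + (b + (c + 1).+1) = (a + b + c).+2)%N by lia.
by case: s; case: t; rewrite /= ?andbF ?andbT ?orbF ?orbT ?muln0 //= !eqSS;
   rewrite ?mul0n ?andbF ?andbT ?orbF ?(andbF, andbT) // => /andP[].
Qed.

(** In a non-zero term the two units are at the same vertex, which has three
    letters; the other vertex has n+2.  There are i+j+6 letters altogether. *)
Lemma muk_eps i j : ((i + j).+1 != n)%N -> muk_basis K n (eps, i) (eps, j) = 0.
Proof.
move=> ijn; rewrite /muk_basis.
apply: big1 => -[p Hp] _; apply: big1 => -[q Hq] /= pq.
apply: big1 => -[p' Hp'] _; apply: big1 => -[q' Hq'] /= pq'.
apply: big1 => s _; apply: big1 => t _.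
apply/eqP; apply: contraNT ijn; rewrite !mulf_eq0 !negb_or => /andP[/andP[_]].
rewrite /cycl !face_word ?between_snd //.
move=> /face_word_neq0 h1 /face_word_neq0; move: h1; rewrite /dualA.
by case: s; case: t => //=; rewrite ?andbF ?orbF //=;
  move: Hp Hq Hp' Hq' pq pq' => /=; lia.
Qed.

(** If both ends of edges at the vertex are units, then it has no other letter
    than the slot 0, and the inputs go to the outputs.  Otherwise the vertex
    takes n-1 inputs; as k < n, these are all the inputs, and both outputs are
    1|. *)
Lemma coproduct_eps k c : (k < n)%N -> (coproduct_basis K n (eps, k))@_c != 0 ->
  [/\ c.1.1 = eps, c.2.1 = eps, (c.1.2 < n)%N & (c.2.2 < n)%N]
  \/ c = ((unitA, 0%N), (unitA, 0%N)).
Proof.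
move=> kn; pose P (x : {malg K[(chain * chain)%type]}) := x@_c != 0 ->
  [/\ c.1.1 = eps, c.2.1 = eps, (c.1.2 < n)%N & (c.2.2 < n)%N]
  \/ c = ((unitA, 0%N), (unitA, 0%N)).
have P0 : P 0 by rewrite /P mcoeff0 eqxx.
have PD x y : P x -> P y -> P (x + y).
  rewrite /P mcoeffD => Px Py; have [->|/Px //] := eqVneq x@_c 0.
  by rewrite add0r.
suff : P (coproduct_basis K n (eps, k)) by [].
rewrite /coproduct_basis.
apply: (big_ind P) => // -[r Hr] _; apply: (big_ind P) => // -[s Hs] /= rs.
apply: (big_ind P) => // -[t Ht] /= st; apply: (big_ind P) => // -[l Hl] /= tl.
apply: (big_ind P) => // p _; apply: (big_ind P) => // q _.
rewrite /P mcoeffU; case e: (_ == c); last by rewrite mulr0n eqxx.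
move/eqP: e => <- /=.
rewrite mulr1n mulf_eq0 negb_or => /andP[_].
rewrite /cycl face_word // between_snd // => /face_word_neq0.
move: Hr Hs Ht Hl rs st tl => /=; clear P P0 PD c.
case: p; case: q => //=; rewrite ?orbF ?andbF // => h1 h2 h3 h4 h5 h6 h7 /eqP h8.
  right; have -> : (s - r)%N = 0%N by lia.
  by have -> : (l - t)%N = 0%N by lia.
left; split => //; lia.
Qed.

Lemma mukL_eq0 (x y : L K) :
  (forall a b, a \in msupp x -> b \in msupp y -> muk_basis K n a b = 0) ->
  mukL n x y = 0.
Proof.
move=> m0; rewrite /mukL big_seq big1 // => a ax; rewrite big_seq big1 // => b yb.
by rewrite m0 // mulr0.
Qed.

Lemma res_umon (a : L K) (y : laurent K) :
  mukL n a (lcoef y 0) = 0 -> res_hres n (umon (-1) a) y = 0.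
Proof.
move=> m0; rewrite /res_hres fsbig1 // => i _ /=.
have [->|i1] := eqVneq i (-1); first by rewrite (_ : -1 - -1 = 0 :> int) // m0 mulr0.
by rewrite /mukL msupp0 big_seq_fset0 mulr0.
Qed.

Lemma homogeneous_umon m (a : chain) :
  homogeneous (chain_odd a) (umon m << a >> : laurent K).
Proof.
apply: laurent_eq => i; rewrite lcoefZ /=; case: eqP => _.
  rewrite parL_lin_ext lin_extU scale1r; apply/malgP => k.
  by rewrite mcoeffZ !mcoeffU; case: eqP; rewrite ?mulr1 ?mulr0.
by rewrite parL_lin_ext lin_ext0 scaler0.
Qed.

Lemma homogeneous_splitting k m : homogeneous false (splitting K n k m).
Proof.
apply: laurent_eq => i /=; rewrite expr0 scale1r /=; case: ifP => _.
  rewrite parL_lin_ext lin_extU; apply/malgP => c.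
  by rewrite mcoeffZ !mcoeffU; case: eqP; rewrite ?mulr1 ?mulr0.
by rewrite parL_lin_ext lin_ext0.
Qed.

Lemma splitting_coef_lt k (m i : int) : i < m -> lcoef (splitting K n k m) i = 0.
Proof. by rewrite /= ltNge => /negbTE ->. Qed.

Lemma splitting_coef k (m : int) (l : nat) : lcoef (splitting K n k m) (m + l%:Z) =
  << (-1) ^+ l * split_coef K n k l *g (eps, (k + n * l + l)%N) >>.
Proof.
rewrite /= (_ : m <= m + l%:Z); last by lia.
by rewrite (_ : absz (m + l%:Z - m)%R = l) //; lia.
Qed.

(** The coefficient of u^0 in u^-1 times the lift is a multiple of
    epsilon|epsilon^(j+n+1), which is too long to pair with any other chain of
    this type. *)
Lemma muk_eps_splitting i j :
  (i < n)%N -> mukL n (<< (eps, i) >> : L K) (lcoef (splitting K n j (-1)) 0) = 0.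
Proof.
move=> ik; apply: mukL_eq0 => a b; rewrite (splitting_coef j (-1) 1).
move=> /(fsubsetP msuppU_le) + /(fsubsetP msuppU_le).
rewrite !inE => /eqP -> /eqP ->; apply: muk_eps; lia.
Qed.

End PairingCoproduct.

(** * Scalars and free algebras *)

Section PsConst.
Context (K : fieldType).

Lemma psconst0 : psconst (0 : K) = 0.
Proof. by []. Qed.

Lemma psconstN (a : K) : psconst (- a) = - psconst a.
Proof. by apply: psP => i /=; case: ifP; rewrite ?oppr0. Qed.

Lemma psconstD (a b : K) : psconst (a + b) = psconst a + psconst b.
Proof. by apply: psP => i /=; case: ifP; rewrite ?addr0. Qed.

Lemma psconst_coef0 (a : K) (f : pseries K) : pscoef (psconst a * f) 0 = a * pscoef f 0.
Proof. by rewrite /= big_ord_recl big_ord0 addr0. Qed.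

Lemma psconstM (a b : K) : psconst (a * b) = psconst a * psconst b.
Proof.
apply: psP => i /=; rewrite big_ord_recl /= subn0 big1 ?addr0 => [|j _].
  by case: ifP; rewrite ?mulr0.
by rewrite mul0r.
Qed.

Lemma pslambda_coef0 (f : pseries K) : pscoef (pslambda * f) 0 = 0.
Proof. by rewrite /= big_ord_recl big_ord0 mul0r addr0. Qed.

Lemma pslambda_coef1 (f : pseries K) : pscoef (pslambda * f) 1 = pscoef f 0.
Proof.
by rewrite /= !big_ord_recl big_ord0 /= /bump /= mul0r add0r addr0 mul1r.
Qed.

End PsConst.

Lemma malg_scalerAr (R : comNzRingType) (M : monomType) (c : R) (x y : {malg R[M]}) :
  x * (c *: y) = c *: (x * y).
Proof.
rewrite (malgMEw (fsubset_refl _) (msuppZ_le c y)) malgME scaler_sumr.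
apply: eq_bigr => m _; rewrite scaler_sumr; apply: eq_bigr => m' _.
apply/malgP=> k; rewrite !mcoeffZ !mcoeffU mulrCA.
by case: (_ == _); rewrite ?mulr1n ?mulr0.
Qed.

Lemma malgU_scale (R : nzRingType) (M : choiceType) (c : R) (m : M) :
  << c *g m >> = c *: << m >> :> {malg R[M]}.
Proof.
by apply/malgP => k; rewrite mcoeffZ !mcoeffU; case: (_ == _); rewrite ?mulr1 ?mulr0.
Qed.

Lemma malg_linear_ind (R : nzRingType) (M : choiceType) (P : {malg R[M]} -> Prop) :
  (forall x y, P x -> P y -> P (x + y)) -> (forall c m, P (c *: << m >>)) ->
  P 0 -> forall x, P x.
Proof.
move=> PD PU P0 x; rewrite [x]monalgE; apply: (big_ind P) => // m _.
by rewrite malgU_scale.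
Qed.

(** * Graph operations on the splitting classes *)

Section SplittingTerms.
Context (K : fieldType) (n : nat).

Lemma rhoL_monomial G c (a : chain) :
  rhoL n G (<< c *g a >> : L K) = c * rho_basis K n G a.
Proof.
rewrite /rhoL msuppU; have [->|_] := eqVneq c 0.
  by rewrite big_seq_fset0 mul0r.
by rewrite big_seq_fset1 mcoeffUU.
Qed.

Lemma rhoL0 G : rhoL n G (0 : L K) = 0.
Proof. by rewrite /rhoL msupp0 big_seq_fset0. Qed.

Lemma rhoL_G3_splitting k m i : rhoL n G3 (lcoef (splitting K n k m) i) = 0.
Proof. by rewrite /=; case: ifP => _; rewrite ?rhoL0 // rhoL_monomial rho_G3 mulr0. Qed.

Lemma rhoL_G2_splitting k (l : nat) : [pchar K] =i pred0 -> (k < n)%N ->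
  rhoL n G2 (lcoef (splitting K n k l%:Z) 1)
  = if (k == n - 1)%N && (l == 1)%N then n%:R else 0.
Proof.
move=> charK kn; case: l => [|[|l]].
- rewrite -[1]add0r (splitting_coef K n k 0 1) rhoL_monomial rho_G2 //.
  by rewrite andbF ifF ?mulr0 //; lia.
- rewrite -[X in lcoef _ X]addr0 (splitting_coef K n k 1 0) rhoL_monomial rho_G2 //.
  rewrite /split_coef big_ord0 mul1r mul1r muln0 !addn0 andbT.
  by have -> : (k.+1 == n) = (k == n - 1)%N by lia.
by rewrite splitting_coef_lt ?rhoL0 ?andbF.
Qed.

Lemma coproductL_monomial c (a : chain) :
  coproductL n (<< c *g a >> : L K) = c *: coproduct_basis K n a.
Proof. exact: lin_extU. Qed.

Lemma coproduct_splitting k (l : nat) c : (k < n)%N ->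
  c \in msupp (coproductL n (lcoef (splitting K n k l%:Z) 0)) ->
  [/\ c.1.1 = eps, c.2.1 = eps, (c.1.2 < n)%N & (c.2.2 < n)%N]
  \/ c = ((unitA, 0%N), (unitA, 0%N)).
Proof.
move=> kn; case: l => [|l].
  rewrite -[X in lcoef _ X]addr0 (splitting_coef K n k 0 0) muln0 !addn0.
  rewrite coproductL_monomial => /(fsubsetP (msuppZ_le _ _)).
  by rewrite -mcoeff_neq0; apply: coproduct_eps.
by rewrite splitting_coef_lt // /coproductL linext0 msupp0 inE.
Qed.

End SplittingTerms.

(** * Deformed Fock modules

    The free algebra, its differential d and its left ideal J enter the argument
    only through the hypotheses stated here for an algebra W. *)

Section FockModule.
Context (K : fieldType) (n : nat) (W : lalgType (pseries K)).
Hypothesis W_scalerAr : forall (c : pseries K) (x y : W), x * (c *: y) = c *: (x * y).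

Context (d : W -> W).
Hypotheses (dD : forall x y, d (x + y) = d x + d y)
  (dZ : forall c x, d (c *: x) = c *: d x).

(** This and the next lemma extend the Leibniz rule from words to their linear
    combinations. *)
Lemma leibniz_add (g a b z z' : W) :
  d (g * z) = a * z + b * d z -> d (g * z') = a * z' + b * d z' ->
  d (g * (z + z')) = a * (z + z') + b * d (z + z').
Proof. by move=> h h'; rewrite mulrDr !dD h h' !mulrDr addrACA. Qed.

Lemma leibniz_scale (c : pseries K) (g a b z : W) :
  d (g * z) = a * z + b * d z -> d (g * (c *: z)) = a * (c *: z) + b * d (c *: z).
Proof. by move=> h; rewrite !(W_scalerAr, dZ) h scalerDr. Qed.

Context (gen : laurent K -> W).
Hypotheses
  (d_genM : forall y z, d (gen y * z) = gen (dlau n y) * z + gen (parlau y) * d z)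
  (d1 : d 1 = 0).

(** The induction step for d^2 = 0: P is the product of a word w, D is its
    derivative, and d is applied to the derivative of x w.  The two middle
    terms cancel because the parity operator anticommutes with b + uB. *)
Lemma ideal_dd_cons (I : W -> Prop) x P D :
  (forall x y, I x -> I y -> I (x + y)) -> (forall x y, I y -> I (x * y)) ->
  (forall x y, I x -> I (x * y)) -> I (gen 0) -> (forall y, I (gen (- y) + gen y)) ->
  d P = D -> I (d D) -> I (d (gen (dlau n x) * P + gen (parlau x) * D)).
Proof.
move=> ID IMl IMr I0 IN dP IdD.
rewrite dD !d_genM dP dlau_dlau parlau_dlau -addrA; apply: (ID); first exact: IMr.
rewrite addrA -mulrDl; apply: (ID); first exact: (IMr _ _ (IN _)).
exact: IMl.
Qed.

Context (J : W -> Prop).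
Hypotheses (JD : forall x y, J x -> J y -> J (x + y))
  (JM : forall x y, J y -> J (x * y))
  (Jd : forall x, J x -> J (d x))
  (Jdd : forall x, J (d (d x)))
  (Jgen0 : forall z, J (gen 0 * z))
  (Jlin : forall a x y, J (gen (a *: x + y) - psconst a *: gen x - gen y))
  (Jcomm : forall p q x y, homogeneous p x -> homogeneous q y ->
     J (gen x * gen y - (-1) ^+ (p && q) * (gen y * gen x)
                - psconst (res_hres n x y) *: 1))
  (Jflat : forall x, J (pslambda *: x) -> J x).

(** Equality in W / J.  As J is a left ideal, congruences may be multiplied on
    the left only. *)
Definition eqJ x y := J (x - y).
Local Notation "x === y" := (eqJ x y) (at level 70).

Lemma J0 : J 0.
Proof. by rewrite -(mul0r (gen 0 * 0)); apply: JM; apply: Jgen0. Qed.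

Lemma JN x : J x -> J (- x).
Proof. by move=> Jx; rewrite -mulN1r; apply: JM. Qed.

Lemma JZ c x : J x -> J (c *: x).
Proof. by move=> Jx; rewrite -[c *: x]mul1r W_scalerAr scalerAl; apply: JM. Qed.

Lemma J_eqJ0 x : J x -> x === 0.
Proof. by rewrite /eqJ subr0. Qed.

Lemma eqJ0_J x : x === 0 -> J x.
Proof. by rewrite /eqJ subr0. Qed.

Lemma eqJ_refl x : x === x.
Proof. by rewrite /eqJ subrr; apply: J0. Qed.

Lemma eqJ_sym x y : x === y -> y === x.
Proof. by move/JN; rewrite opprB. Qed.

Lemma eqJ_trans y x z : x === y -> y === z -> x === z.
Proof. by move=> h h'; have := JD h h'; rewrite addrA subrK. Qed.

Lemma eqJD x y x' y' : x === y -> x' === y' -> x + x' === y + y'.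
Proof. by move=> h h'; have := JD h h'; rewrite /eqJ opprD addrACA. Qed.

Lemma eqJZ c x y : x === y -> c *: x === c *: y.
Proof. by move/(JZ c); rewrite /eqJ scalerBr. Qed.

Lemma eqJM z x y : x === y -> z * x === z * y.
Proof. by move/(JM z); rewrite /eqJ mulrBr. Qed.

Lemma dN x : d (- x) = - d x.
Proof. by rewrite -[- x]scaleN1r dZ scaleN1r. Qed.

Lemma d0 : d 0 = 0.
Proof. by have := dZ 0 0; rewrite !scale0r. Qed.

Lemma eqJ_d x y : x === y -> d x === d y.
Proof. by move/Jd; rewrite dD dN. Qed.

Lemma eqJ_flat x y : pslambda *: x === pslambda *: y -> x === y.
Proof. by rewrite /eqJ -scalerBr; apply: Jflat. Qed.

(** Equality in W / (J + lambda W). *)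
Definition eqlam x y := exists h, x === y + pslambda *: h.
Local Notation "x =l= y" := (eqlam x y) (at level 70).

Lemma eqJ_eqlam x y : x === y -> x =l= y.
Proof. by move=> h; exists 0; rewrite scaler0 addr0. Qed.

Lemma eqlam_refl x : x =l= x.
Proof. exact/eqJ_eqlam/eqJ_refl. Qed.

Lemma eqlam_sym x y : x =l= y -> y =l= x.
Proof.
case=> h e; exists (- h); rewrite scalerN; apply: eqJ_sym.
by have := eqJD e (eqJ_refl (- (pslambda *: h))); rewrite addrK.
Qed.

Lemma eqlam_trans y x z : x =l= y -> y =l= z -> x =l= z.
Proof.
case=> h e [h' e']; exists (h' + h); apply: eqJ_trans e _.
by rewrite scalerDr addrA; apply: eqJD e' (eqJ_refl _).
Qed.

Lemma eqlamD x y x' y' : x =l= y -> x' =l= y' -> x + x' =l= y + y'.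
Proof.
by case=> h e [h' e']; exists (h + h'); rewrite scalerDr addrACA; apply: eqJD.
Qed.

Lemma eqlamZ c x y : x =l= y -> c *: x =l= c *: y.
Proof.
case=> h e; exists (c *: h); have := eqJZ c e.
by rewrite scalerDr !scalerA mulrC.
Qed.

Lemma eqlamM z x y : x =l= y -> z * x =l= z * y.
Proof. by case=> h e; exists (z * h); have := eqJM z e; rewrite mulrDr W_scalerAr. Qed.

Lemma eqlam_addl x h : x =l= x + pslambda *: h.
Proof. by exists (- h); rewrite scalerN addrK; apply: eqJ_refl. Qed.

Lemma closed_gen y : dlau n y = 0 -> d (gen y) === 0.
Proof.
by move=> y0; rewrite -[gen y]mulr1 d_genM d1 mulr0 addr0 y0; exact: J_eqJ0.
Qed.

Lemma closed_genM y z : dlau n y = 0 -> d z === 0 -> d (gen y * z) === 0.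
Proof.
move=> y0 z0; rewrite d_genM y0 -[X in _ === X]addr0.
apply: eqJD; first exact: J_eqJ0.
by have := eqJM (gen (parlau y)) z0; rewrite mulr0.
Qed.

Lemma closed_prod (I : Type) (s : seq I) (f : I -> laurent K) (m : I -> nat) :
  (forall i, dlau n (f i) = 0) -> d (\prod_(i <- s) gen (f i) ^+ m i) === 0.
Proof.
move=> f0; elim: s => [|i s IH]; first by rewrite big_nil d1; apply: eqJ_refl.
rewrite big_cons; elim: (m i) => [|k IHk]; first by rewrite mul1r.
by rewrite exprS -mulrA; apply: closed_genM.
Qed.

Context (P : lmodType (pseries K)) (ev : P -> W).
Hypotheses (evD : forall p q, ev (p + q) = ev p + ev q)
  (evZ : forall c p, ev (c *: p) = c *: ev p)
  (dev : forall p, d (ev p) === 0)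
  (Jhom : forall x, J (d x) -> exists! p, exists z, J (x - ev p - d z)).

Lemma evN p : ev (- p) = - ev p.
Proof. by rewrite -[- p]scaleN1r evZ scaleN1r. Qed.

Lemma homologousP x p z : x === ev p + d z <-> J (x - ev p - d z).
Proof. by rewrite /eqJ opprD addrA. Qed.

(** Applying d to ev p = d z + lambda h shows that lambda d h is in J.  Without
    torsion, h is closed; if p' is its class, then lambda p' and p are both the
    class of ev p. *)
Lemma exact_mod_lambda p z : ev p =l= d z -> exists p', p = pslambda *: p'.
Proof.
case=> h e.
have : pslambda *: d h === pslambda *: 0.
  rewrite scaler0 -dZ; apply: eqJ_sym; apply: eqJ_trans (eqJ_sym (dev p)) _.
  apply: eqJ_trans (eqJ_d e) _; rewrite dD -[X in _ === X]add0r.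
  by apply: eqJD (eqJ_refl _); exact: J_eqJ0.
move/eqJ_flat/eqJ0_J/Jhom => [p' [[z' /homologousP e'] _]]; exists p'.
have [q [_ uq]] := Jhom (eqJ0_J (dev p)).
transitivity q; last apply: uq; first (apply/esym/uq; exists 0; apply/homologousP).
  by rewrite d0 addr0; apply: eqJ_refl.
exists (z + pslambda *: z'); apply/homologousP; apply: eqJ_trans e _.
rewrite evZ dD dZ addrCA -scalerDr.
by apply: eqJD (eqJ_refl _) _; apply: eqJZ.
Qed.

(** Without torsion, t = T + d A + lambda h is closed; q is its class.  The
    difference q - q0 is exact modulo lambda. *)
Lemma class_of_relation x T A h q0 :
  d x === 0 -> x === pslambda *: (T + d A) + pslambda *: (pslambda *: h) ->
  T =l= ev q0 ->
  exists q, (forall p, (exists z, J (x - ev p - d z)) <-> p = pslambda *: q) /\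
    exists r, q = q0 + pslambda *: r.
Proof.
rewrite -scalerDr => dx ex eT; set t := T + d A + pslambda *: h in ex.
have : pslambda *: d t === pslambda *: 0.
  rewrite scaler0 -dZ; apply: eqJ_trans dx; exact/eqJ_d/eqJ_sym.
move/eqJ_flat/eqJ0_J/Jhom => [q [[z /homologousP et] _]].
have exq : x === ev (pslambda *: q) + d (pslambda *: z).
  by rewrite evZ dZ -scalerDr; apply: eqJ_trans ex _; apply: eqJZ.
exists q; split.
  have [p0 [_ up]] := Jhom (eqJ0_J dx).
  have e0 : p0 = pslambda *: q by apply: up; exists (pslambda *: z); apply/homologousP.
  move=> p; split=> [hp|->]; first by rewrite -e0; apply/esym/up.
  by exists (pslambda *: z); apply/homologousP.
have [|r er] := @exact_mod_lambda (q - q0) (A - z); last first.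
  by exists r; rewrite -er addrC subrK.
rewrite evD evN dD dN.
have e1 : ev q =l= t - d z.
  apply: eqJ_eqlam; apply: eqJ_sym.
  by have := eqJD et (eqJ_refl (- d z)); rewrite addrK.
apply: eqlam_trans (eqlamD e1 (eqlam_refl _)) _.
have e2 : t =l= ev q0 + d A.
  apply: eqlam_trans (eqlam_sym (eqlam_addl _ _)) _.
  by apply: eqlamD eT (eqlam_refl _).
apply: eqlam_trans (eqlamD (eqlamD e2 (eqlam_refl _)) (eqlam_refl _)) _.
by rewrite (addrC (ev q0)) -!addrA (addrCA (ev q0)) subrr addr0; apply: eqlam_refl.
Qed.

(* The constant coefficient of a polynomial. *)
Context (cf : P -> pseries K).
Hypotheses (cfD : forall p q, cf (p + q) = cf p + cf q)
  (cfZ : forall c p, cf (c *: p) = c * cf p).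

Definition constant_term (x : W) (c : K) :=
  exists2 q, x =l= ev q & pscoef (cf q) 0 = c.

Lemma constant_term_eqlam x y c : x =l= y -> constant_term y c -> constant_term x c.
Proof. by move=> e [q e' <-]; exists q => //; apply: eqlam_trans e'. Qed.

Lemma ev0 : ev 0 = 0.
Proof. by have := evZ 0 0; rewrite !scale0r. Qed.

Lemma constant_term0 : constant_term 0 0.
Proof.
exists 0; first by rewrite ev0; apply: eqlam_refl.
by have := cfZ 0 0; rewrite scale0r mul0r => ->.
Qed.

Lemma constant_termD x y a b :
  constant_term x a -> constant_term y b -> constant_term (x + y) (a + b).
Proof.
by move=> [p ep <-] [q eq <-]; exists (p + q); rewrite ?evD ?cfD //; apply: eqlamD.
Qed.

Lemma constant_termZ (a : K) x c :
  constant_term x c -> constant_term (psconst a *: x) (a * c).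
Proof.
move=> [p ep <-]; exists (psconst a *: p); first by rewrite evZ; apply: eqlamZ.
by rewrite cfZ psconst_coef0.
Qed.

Lemma constant_term_sum0 (I : eqType) (s : seq I) (F : I -> W) :
  (forall i, i \in s -> constant_term (F i) 0) -> constant_term (\sum_(i <- s) F i) 0.
Proof.
move=> gF; rewrite big_seq; apply: (big_ind (fun x => constant_term x 0)) => //.
  exact: constant_term0.
by move=> x y gx gy; rewrite -[0]addr0; apply: constant_termD.
Qed.

Lemma relation_eqJ x A h : J (x - pslambda *: A - pslambda *: (pslambda *: h)) ->
  x === pslambda *: A + pslambda *: (pslambda *: h).
Proof. by rewrite /eqJ opprD addrA. Qed.

Lemma semilinear0 (H : laurent K -> W) :
  (forall a x y, H (a *: x + y) = psconst a *: H x + H y) -> H 0 = 0.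
Proof.
move=> /(_ 1 0 0); rewrite scaler0 addr0 scale1r => e.
by apply: (addrI (H 0)); rewrite addr0 -e.
Qed.

Lemma invariant_of_relation x T A h c :
  d x === 0 -> J (x - pslambda *: (T + d A) - pslambda *: (pslambda *: h)) ->
  constant_term T c ->
  exists q, (forall p, (exists z, J (x - ev p - d z)) <-> p = q) /\
    pscoef (cf q) 1 = c.
Proof.
move=> dx /relation_eqJ ex [q0 e0 <-].
have [q [cq [r rq]]] := class_of_relation dx ex e0.
exists (pslambda *: q); split=> //.
rewrite cfZ pslambda_coef1 rq cfD cfZ.
by rewrite -[LHS]/(pscoef (cf q0) 0 + pscoef (pslambda * cf r) 0) pslambda_coef0 addr0.
Qed.

(** The coefficient T_1 + T_2 + T_3 of lambda in the defining relation. *)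
Definition relation_term (a : laurent K) : W :=
  psconst 2%:R^-1 *: (\sum_(c <- msupp (coproductL n (lcoef a 0)))
     psconst (coproductL n (lcoef a 0))@_c
     *: (gen (umon (-1) << c.1 >>) * gen (umon (-1) << c.2 >>)))
  + psconst (24%:R^-1 * rhoL n G2 (lcoef a 1)) *: 1
  + psconst (- 4%:R^-1 * rhoL n G3 (lcoef a 0)) *: 1.

Context (H : laurent K -> W).
Hypotheses (H_linear : forall a x y, H (a *: x + y) = psconst a *: H x + H y)
  (Jrel : forall a, is_power a -> exists h,
    J (gen a - pslambda *: (relation_term a + d (H a) + H (dlau n a))
       - pslambda *: (pslambda *: h))).

Let polar (a : chain) : laurent K := umon (-1) << a >>.
Let polar_lift (s : nat) : laurent K := splitting K n s (-1).

Lemma power_eqlam0 y : is_power y -> gen y =l= 0.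
Proof.
move=> /Jrel[h /relation_eqJ]; set A := _ + H _ => e; exists (A + pslambda *: h).
by rewrite add0r scalerDr.
Qed.

(** The difference of the two arguments is in L[[u]]. *)
Lemma gen_splitting s : gen (polar_lift s) =l= gen (polar (eps, s)).
Proof.
have := Jlin 1 (polar (eps, s)) (polar_lift s - polar (eps, s)).
rewrite scale1r (addrC (polar _)) subrK scale1r -addrA -opprD => e.
apply: eqlam_trans (eqJ_eqlam e) _; rewrite -[X in _ =l= X]addr0.
apply: eqlamD (eqlam_refl _) (power_eqlam0 _) => i i0.
rewrite -[LHS]/(lcoef (polar_lift s) i - lcoef (polar (eps, s)) i).
have [im1|im1] := eqVneq i (-1).
  have -> : lcoef (polar (eps, s)) i = << (eps, s) >> by rewrite /= im1 eqxx.
  rewrite im1 /polar_lift -[X in lcoef _ X]addr0 (splitting_coef K n s (-1) 0).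
  by rewrite /split_coef big_ord0 muln0 !addn0 mul1r subrr.
rewrite splitting_coef_lt; last by lia.
by rewrite /= (negbTE im1) subrr.
Qed.

Lemma even_commute x y : homogeneous false x -> homogeneous false y ->
  res_hres n x y = 0 -> gen x * gen y === gen y * gen x.
Proof.
move=> hx hy r0; have := Jcomm hx hy.
by rewrite r0 psconst0 scale0r subr0 mul1r.
Qed.

Lemma homogeneous_umon_eps s : homogeneous false (polar (eps, s)).
Proof. exact: (homogeneous_umon K (-1) (eps, s)). Qed.

(** Only a factor on the right can be replaced by its lift, so the factors are
    exchanged between the two replacements. *)
Lemma gen_pair_splitting s s' : (s < n)%N ->
  gen (polar (eps, s)) * gen (polar (eps, s')) =l=
  gen (polar_lift s') * gen (polar_lift s).
Proof.
move=> sn; apply: eqlam_trans (eqlamM _ (eqlam_sym (gen_splitting s'))) _.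
have r0 : res_hres n (polar (eps, s)) (polar_lift s') = 0.
  exact/res_umon/muk_eps_splitting.
have c := even_commute (homogeneous_umon_eps s) (homogeneous_splitting K n s' (-1)) r0.
apply: eqlam_trans (eqJ_eqlam c) _; exact/eqlamM/eqlam_sym/gen_splitting.
Qed.

Lemma res_umon_umon a b : res_hres n (polar a) (polar b) = 0.
Proof. by apply/res_umon/mukL_eq0 => ? ?; rewrite msupp0 => _; rewrite inE. Qed.

Lemma gen_pair_comm s s' :
  gen (polar (eps, s)) * gen (polar (eps, s')) ===
  gen (polar (eps, s')) * gen (polar (eps, s)).
Proof.
apply: even_commute (res_umon_umon _ _); exact: homogeneous_umon_eps.
Qed.

(** The class u^-1 1| is odd, so twice its square is its commutator with itself,
    a residue that vanishes. *)
Lemma gen_unit_sqr : 2%:R != 0 :> K ->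
  gen (polar (unitA, 0%N)) * gen (polar (unitA, 0%N)) === 0.
Proof.
move=> two; set g := gen _; apply: J_eqJ0.
have h := homogeneous_umon K (-1) (unitA, 0%N) : homogeneous true (polar _).
have := Jcomm h h; rewrite res_umon_umon psconst0 scale0r subr0 expr1 mulN1r opprK.
move/(JZ (psconst 2%:R^-1)); rewrite -/g -mulr2n -scaler_nat scalerA.
have -> : psconst 2%:R^-1 * 2%:R = 1 :> pseries K.
  have -> : 2%:R = psconst 2%:R :> pseries K by rewrite !mulr2n psconstD.
  by rewrite -psconstM mulVf.
by rewrite scale1r.
Qed.

Hypothesis ev_one : exists2 p, ev p = 1 & pscoef (cf p) 0 = 1.
(* The enumeration of the variables of a monomial decides on the order. *)
Hypothesis ev_pair : forall s s', (s < n)%N -> (s' < n)%N -> exists p,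
  (ev p = gen (polar_lift s) * gen (polar_lift s') \/
   ev p = gen (polar_lift s') * gen (polar_lift s))
  /\ pscoef (cf p) 0 = 0.

Lemma constant_term_coproduct (D : {malg K[(chain * chain)%type]}) : 2%:R != 0 :> K ->
  (forall c, c \in msupp D ->
    [/\ c.1.1 = eps, c.2.1 = eps, (c.1.2 < n)%N & (c.2.2 < n)%N]
    \/ c = ((unitA, 0%N), (unitA, 0%N))) ->
  constant_term (psconst 2%:R^-1 *: \sum_(c <- msupp D)
     psconst D@_c *: (gen (umon (-1) << c.1 >>) * gen (umon (-1) << c.2 >>))) 0.
Proof.
move=> two Dc; rewrite -[X in constant_term _ X](mulr0 (2%:R^-1 : K)).
apply: constant_termZ; apply: constant_term_sum0 => c /Dc cP.
rewrite -[X in constant_term _ X](mulr0 (D@_c)); apply: constant_termZ.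
case: cP => [|->]; last first.
  by apply: constant_term_eqlam constant_term0; apply: eqJ_eqlam; apply: gen_unit_sqr.
case: c => -[[] s] [[] s'] [] //= _ _ sn sn'.
have [p [[ep|ep] p0]] := ev_pair sn sn'; exists p => //; rewrite ep.
  apply: eqlam_trans (eqJ_eqlam (gen_pair_comm s s')) _.
  exact: gen_pair_splitting.
exact: gen_pair_splitting.
Qed.

Lemma constant_term_scalar (a : K) : constant_term (psconst a *: 1) a.
Proof.
case: ev_one => e e1 ce; rewrite -[X in constant_term _ X]mulr1; apply: constant_termZ.
by exists e => //; rewrite e1; apply: eqlam_refl.
Qed.

Lemma constant_term_relation k (l : nat) : 2%:R != 0 :> K -> (k < n)%N ->
  constant_term (relation_term (splitting K n k l%:Z))
    (24%:R^-1 * rhoL n G2 (lcoef (splitting K n k l%:Z) 1)).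
Proof.
move=> two kn; rewrite /relation_term rhoL_G3_splitting mulr0.
rewrite -[X in constant_term _ X]addr0.
apply: constant_termD; last exact: constant_term_scalar.
rewrite -[X in constant_term _ X]add0r.
apply: constant_termD; last exact: constant_term_scalar.
by apply: constant_term_coproduct => // c; apply: coproduct_splitting.
Qed.

Lemma class_splitting k (l : nat) : [pchar K] =i pred0 -> (k < n)%N ->
  exists q,
    (forall p, (exists z, J (gen (splitting K n k l%:Z) - ev p - d z)) <-> p = q) /\
    pscoef (cf q) 1 = if (k == n - 1)%N && (l == 1)%N then n%:R / 24%:R else 0.
Proof.
move=> charK kn.
have pw : is_power (splitting K n k l%:Z).
  by move=> i i0; rewrite splitting_coef_lt //; lia.
have two : 2%:R != 0 :> K by rewrite ((pcharf0P K).1 charK).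
have [h] := Jrel pw; rewrite dlau_splitting // (semilinear0 H_linear) addr0 => e.
have cl : d (gen (splitting K n k l%:Z)) === 0 by apply/closed_gen/dlau_splitting.
have [q [cq qc]] := invariant_of_relation cl e (constant_term_relation l two kn).
exists q; split=> //; rewrite qc rhoL_G2_splitting //.
by case: ifP; rewrite ?mulr0 // mulrC.
Qed.

End FockModule.

(** * The free algebra *)

Section FreeAlgebra.
Context (K : fieldType) (n : nat).
Local Notation freeW := (freeW K).
Local Notation I := (@weyl_ideal K n).

Lemma dW0 : dW n (0 : freeW) = 0.
Proof. exact: lin_ext0. Qed.

Lemma dWD (x y : freeW) : dW n (x + y) = dW n x + dW n y.
Proof. exact: lin_extD. Qed.

Lemma dWZ c (x : freeW) : dW n (c *: x) = c *: dW n x.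
Proof. exact: lin_extZ. Qed.

Lemma prod_gen (s : seq (laurent K)) : \prod_(y <- s) gen y = << FMonom s >> :> freeW.
Proof.
elim: s => [|x s IH]; first by rewrite big_nil; congr << _ >>; rewrite -fmoneE.
rewrite big_cons IH /gen malgM_def fgmulUU mulr1; congr << _ >>.
by rewrite /mmul /= fmmulE fmuE.
Qed.

Lemma dW_prod_gen (s : seq (laurent K)) : dW n (\prod_(y <- s) gen y) = dword n s.
Proof. by rewrite prod_gen -[LHS]/(lin_ext _ _) lin_extU scale1r. Qed.

Lemma dW_gen_mul (y : laurent K) (z : freeW) :
  dW n (gen y * z) = gen (dlau n y) * z + gen (parlau y) * dW n z.
Proof.
elim/malg_linear_ind: z => [z z'|c w|].
- exact: (leibniz_add dWD).
- apply: (leibniz_scale (@malg_scalerAr _ _) dWZ).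
  rewrite -[w]fmK -prod_gen dW_prod_gen.
  have -> : gen y * \prod_(x <- w) gen x = \prod_(x <- y :: (w : seq _)) gen x :> freeW.
    by rewrite big_cons.
  by rewrite dW_prod_gen.
by rewrite !mulr0 dW0 mulr0 addr0.
Qed.

Lemma dW1 : dW n (1 : freeW) = 0.
Proof. by rewrite -(big_nil 1 *%R predT (@gen K)) dW_prod_gen. Qed.

Lemma weyl_gen0 : I (gen 0).
Proof.
have h := @weyl_linear K n (-1) 0 0.
suff <- : gen (-1 *: 0 + 0) - sc (-1) (gen 0) - gen 0 = gen 0 :> freeW by [].
by rewrite scaler0 addr0 /sc psconstN scaleN1r opprK addrK.
Qed.

Lemma weyl_genN (x : laurent K) : I (gen (- x) + gen x).
Proof.
have h := weyl_add (@weyl_linear K n (-1) x 0) weyl_gen0.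
by move: h; rewrite /sc psconstN !scaleN1r opprK addr0 subrK.
Qed.

Lemma weyl0 : I 0.
Proof. by rewrite -(mul0r (gen 0)); apply/weyl_mull/weyl_gen0. Qed.

Lemma weyl_dW_dword (w : seq (laurent K)) : I (dW n (dword n w)).
Proof.
elim: w => [|x w IH]; first by rewrite /= dW0; apply: weyl0.
apply: (ideal_dd_cons dWD dW_gen_mul) IH => //.
- exact: weyl_add.
- exact: weyl_mull.
- exact: weyl_mulr.
- exact: weyl_gen0.
- exact: weyl_genN.
- exact: dW_prod_gen.
Qed.

Lemma weyl_dW_dW (x : freeW) : I (dW n (dW n x)).
Proof.
elim/malg_linear_ind: x => [x y Ix Iy|c w|].
- by rewrite dWD (dWD (dW n x)); apply: weyl_add.
- rewrite dWZ (dWZ c (dW n _)) -[w]fmK -prod_gen dW_prod_gen -mul_malgC.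
  exact/weyl_mull/weyl_dW_dword.
by rewrite !dW0; apply: weyl0.
Qed.

Local Notation fock_poly := {malg (pseries K)[{cmonom ((nat * 'I_n)%type)}]}.

Lemma fock_evalD (p q : fock_poly) : fock_eval (p + q) = fock_eval p + fock_eval q.
Proof. exact: lin_extD. Qed.

Lemma fock_evalZ c (p : fock_poly) : fock_eval (c *: p) = c *: fock_eval p.
Proof. exact: lin_extZ. Qed.

Lemma fock_eval0 : fock_eval (0 : fock_poly) = 0.
Proof. exact: lin_ext0. Qed.

Lemma fock_evalU (m : {cmonom ((nat * 'I_n)%type)}) :
  fock_eval << m >> = fock_monomial K m.
Proof. by rewrite -[LHS]/(lin_ext _ _) lin_extU scale1r. Qed.

Lemma fock_eval_one : exists2 p : fock_poly, fock_eval p = 1 & pscoef (p@_mone) 0 = 1.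
Proof.
exists << mone >>; last by rewrite mcoeffU eqxx.
by rewrite fock_evalU /fock_monomial mdom1 big_seq_fset0.
Qed.

Lemma fock_monomial_pair (v w : nat * 'I_n) :
  let g (v : nat * 'I_n) := gen (splitting K n v.2 (- (v.1.+1)%:Z)) in
  let M := fock_monomial K (mmul (ucm v) (ucm w)) in
  M = g v * g w \/ M = g w * g v.
Proof.
move=> g M; have [e|vw] := eqVneq v w.
  left; rewrite /M /fock_monomial mdomD !mdomU e fsetUid big_seq_fset1.
  by rewrite cmM !cmUU expr2.
have ps : perm_eq (finsupp (mmul (ucm v) (ucm w))) [:: v; w].
  apply: uniq_perm; rewrite ?fset_uniq //= ?inE ?vw // => x.
  by rewrite mdomD !mdomU !inE.
(* The support lists the two variables in the order of their enumeration. *)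
have s2 (s : seq (nat * 'I_n)) : perm_eq s [:: v; w] -> s = [:: v; w] \/ s = [:: w; v].
  move=> psvw; move: (perm_size psvw) (perm_uniq psvw) (perm_mem psvw).
  case: s {psvw} => [|a [|b [|? ?]]] //= _; rewrite !inE vw !andbT => ab mem.
  move: (mem a) (mem b) ab; rewrite !inE !eqxx orbT /=.
  move=> /esym/orP[/eqP->|/eqP->] /esym/orP[/eqP->|/eqP->];
    rewrite ?eqxx //; by [left|right].
have [e e'] : mmul (ucm v) (ucm w) v = 1%N /\ mmul (ucm v) (ucm w) w = 1%N.
  by rewrite !cmM !cmUU !cmU (negbTE vw) eq_sym (negbTE vw).
rewrite /M /fock_monomial.
by have [->|->] := s2 _ ps; [left|right]; rewrite big_cons big_seq1 e e' !expr1.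
Qed.

Lemma fock_eval_pair s s' : (s < n)%N -> (s' < n)%N -> exists p : fock_poly,
  (fock_eval p = gen (splitting K n s (-1)) * gen (splitting K n s' (-1)) \/
   fock_eval p = gen (splitting K n s' (-1)) * gen (splitting K n s (-1)))
  /\ pscoef (p@_mone) 0 = 0.
Proof.
move=> sn sn'; pose v : nat * 'I_n := (0%N, Ordinal sn).
pose w : nat * 'I_n := (0%N, Ordinal sn').
exists << mmul (ucm v) (ucm w) >>; rewrite fock_evalU; split.
  exact: (fock_monomial_pair v w).
by rewrite mcoeffU cmM_eq1 cm1_eq1.
Qed.

Context (J : freeW -> Prop) (HJ : deformed_fock n J).

Lemma J_gen0M z : J (gen 0 * z).
Proof. exact/(fock_weyl HJ)/weyl_mulr/weyl_gen0. Qed.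

Lemma J_dW_fock_eval (p : fock_poly) : eqJ (K := K) (W := freeW) J (dW n (fock_eval p)) 0.
Proof.
apply: J_eqJ0; elim/malg_linear_ind: p => [p q Jp Jq|c m|].
- by rewrite fock_evalD dWD; apply: (fock_add HJ).
- rewrite fock_evalZ dWZ fock_evalU -mul_malgC; apply: (fock_mul HJ).
  have := closed_prod dW_gen_mul dW1 (fock_add HJ) (fock_mul HJ) J_gen0M
    (finsupp m) m (fun v => dlau_splitting K (- (v.1.+1)%:Z) (ltn_ord v.2)).
  exact: eqJ0_J.
by rewrite fock_eval0 dW0; apply/(fock_weyl HJ)/weyl0.
Qed.

End FreeAlgebra.

(** * The invariant of type (1,1) *)

Theorem proposition2p7 (K : fieldType) (n : nat) (J : freeW K -> Prop)
    (k l : nat) :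
  [pchar K] =i pred0 -> (1 <= n)%N -> deformed_fock n J ->
  (k <= n - 1)%N ->
  GW11 n J k l = if (k == n - 1)%N && (l == 1)%N then n%:R / 24%:R else 0.
Proof.
move=> charK n1 HJ kn; have {}kn : (k < n)%N by lia.
have [H [H_linear Jrel]] := fock_relation HJ.
have [q [cq <-]] := class_splitting (@malg_scalerAr _ _) (@dWD K n) (@dWZ K n)
  (@dW_gen_mul K n) (@dW1 K n) (fock_add HJ) (fock_mul HJ) (fock_d HJ)
  (fun x => fock_weyl HJ (weyl_dW_dW n x)) (J_gen0M HJ)
  (fun a x y => fock_weyl HJ (weyl_linear n a x y))
  (fun p q x y hp hq => fock_weyl HJ (weyl_commutator n hp hq)) (fock_flat HJ)
  (@fock_evalD K n) (@fock_evalZ K n) (J_dW_fock_eval HJ) (fock_homology HJ)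
  (cf := fun p => p@_mone) (mcoeffD _) (fun c p => mcoeffZ c p _) H_linear Jrel
  (fock_eval_one K n) (@fock_eval_pair K n) l charK kn.
rewrite /GW11 /fock_class; congr (pscoef (_@_mone) 1).
case: xgetP => [p _|]; first by move/cq.
by move/(_ q); case; apply/cq.
Qed.
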